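(* Assume $0<M<1/2$ and $\mathbb{E}|\tau|^2\le A$. Let $\{\boldsymbol{y}_1,\dots,\boldsymbol{y}_n\}\subset[0,1]^d$ be a low-discrepancy point set. By choosing $R=\sqrt{\frac{2}{1-2M}\log n}+1$, we obtain $$\sup_{\substack{h/g\in G_e(M,B,2)\\ \mathbb{E}|\tau|^2\le A}}\left|\widehat I_n^R(h_{\mathrm{IS}})-\mathbb{E}[h(W)]\right|=O\left(n^{-1}(\log n)^{\frac{3d}{2}-1}\right),$$ where the supremum is over all $h$ and all $\tau$ (with density $g$, as described in the context) satisfying $h/g\in G_e(M,B,2)$ and $\mathbb{E}|\tau|^2\le A$, and $$\widehat I_n^R(h_{\mathrm{IS}})=\frac1n\sum_{j=1}^n h_{\mathrm{IS}}\circ P_R\circ F^{-1}(\boldsymbol{y}_j).$$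
   Context: $W$ is a standard normal random vector in $\mathbb{R}^d$ with density $\varphi$. $\tau=(\tau_1,\dots,\tau_d)$ is a random vector in $\mathbb{R}^d$ with independent components and density $g(\boldsymbol{x})=\prod_{j=1}^d g_j(x_j)$, where $g_j$ is the marginal density of $\tau_j$; $F_j$ is the distribution function of $\tau_j$, and $F^{-1}(\boldsymbol{y})=(F_1^{-1}(y_1),\dots,F_d^{-1}(y_d))$, with values in $[-\infty,\infty]^d$. $h_{\mathrm{IS}}:=\varphi h/g$ is the weighted function obtained after importance sampling, so that $\mathbb{E}[h(W)]=\mathbb{E}[h_{\mathrm{IS}}(\tau)]$. $|\cdot|$ is the Euclidean norm; $1{:}d=\{1,\dots,d\}$; $\partial^{\boldsymbol{u}}$ is the mixed partial derivative taken once with respect to each $x_j$, $j\in\boldsymbol{u}$. $\mathcal{S}^d(\mathbb{R}^d)$ is the class of functions $f$ on $\mathbb{R}^d$ with $\partial^{\boldsymbol{u}}f$ continuous for all $\boldsymbol{u}\subseteq1{:}d$. For $M>0$, $B>0$, $G_e(M,B,2)=\{f\in\mathcal{S}^d(\mathbb{R}^d):\sup_{\boldsymbol{u}\subseteq1{:}d}|\partial^{\boldsymbol{u}}f(\boldsymbol{x})|\le Be^{M|\boldsymbol{x}|^2}\ \text{for all }\boldsymbol{x}\}$. Projection operator: for $R>1$, $P_R$ acts componentwise, each component being a function $P_R:[-\infty,\infty]\to\mathbb{R}$ such that (i) $P_R(x)=x$ for $x\in[-R+1,R-1]$; (ii) $P_R\in C^1(\mathbb{R})$; (iii) $|P_R'(x)|\le\mathbf{1}_{\{|x|\le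 R\}}$; (iv) $|x|\mathbf{1}_{\{|x|\le R-1\}}+(R-1)\mathbf{1}_{\{|x|>R-1\}}\le|P_R(x)|\le|x|\mathbf{1}_{\{|x|\le R\}}+R\mathbf{1}_{\{|x|>R\}}$; (v) $P_R(\pm\infty)=\lim_{x\to\pm\infty}P_R(x)$. The star discrepancy of $P=\{\boldsymbol{y}_1,\dots,\boldsymbol{y}_n\}$ is $D_n^*(P)=\sup_{\mathcal{I}}\left|\frac1n\sum_{j=1}^n\mathbf{1}_{\mathcal{I}}(\boldsymbol{y}_j)-\lambda(\mathcal{I})\right|$, the supremum being over boxes $\mathcal{I}=\prod_{j=1}^d[0,u_j)\subset[0,1]^d$, with $\lambda$ Lebesgue measure. ''Low-discrepancy'' means $D_n^*\le C(\log n)^{d-1}/n$ with $C$ independent of $n$. The $O$ is as $n\to\infty$, with $d,M,B,A,C$ fixed. *)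

(* Defs.v *)
From HB Require Import structures.
From mathcomp Require Import all_boot all_order all_algebra.
From mathcomp Require Import all_classical all_reals all_analysis.
Set Implicit Arguments.
Unset Strict Implicit.
Unset Printing Implicit Defensive.
Import Order.TTheory GRing.Theory Num.Theory.
Import numFieldNormedType.Exports.
Local Open Scope classical_set_scope.
Local Open Scope ring_scope.

(* Euclidean norm; the norm `|x| of 'rV[R]_d is the sup norm. *)
Definition enorm (R : realType) (d : nat) (x : 'rV[R]_d) : R :=
  Num.sqrt (\sum_(j < d) x 0 j ^+ 2).

(* [mpartial [:: j1; ...; jk] f] is d/dx_j1 (... (d/dx_jk f)).  Since 'D_v is a
   total operator, existence is recorded separately by [ex_mpartial]. *)
Fixpoint mpartial (R : realType) (d : nat) (s : seq 'I_d) (f : 'rV[R]_d -> R) :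
    'rV[R]_d -> R :=
  if s is j :: s' then fun x => 'D_(delta_mx 0 j) (mpartial s' f) x else f.

Fixpoint ex_mpartial (R : realType) (d : nat) (s : seq 'I_d)
    (f : 'rV[R]_d -> R) : Prop :=
  if s is j :: s' then
    ex_mpartial s' f /\
    forall x : 'rV[R]_d, derivable (mpartial s' f) x (delta_mx 0 j)
  else True.

(* The mixed partial derivative d^u, once in each direction j \in u.  The order
   is fixed to that of [enum u]; by Schwarz's theorem it is immaterial for
   functions in the class [Sd] below. *)
Definition dmixed (R : realType) (d : nat) (u : {set 'I_d})
    (f : 'rV[R]_d -> R) : 'rV[R]_d -> R := mpartial (enum u) f.

Definition Sd (R : realType) (d : nat) : set ('rV[R]_d -> R) :=
  [set f | forall u : {set 'I_d},
     ex_mpartial (enum u) f /\ continuous (dmixed u f)].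

Definition Ge2 (R : realType) (d : nat) (M B : R) : set ('rV[R]_d -> R) :=
  [set f | Sd f /\ forall (u : {set 'I_d}) (x : 'rV[R]_d),
     `|dmixed u f x| <= B * expR (M * enorm x ^+ 2)].

Definition is_projection (R : realType) (r : R) (p : \bar R -> R) : Prop :=
  let f := fun x : R => p x%:E in
  [/\ forall x : R, - r + 1 <= x <= r - 1 -> f x = x,
      (forall x : R, derivable f x 1) /\ continuous (derive1 f),
      forall x : R, `|derive1 f x| <= (`|x| <= r)%R%:R,
      forall x : R,
        `|x| * (`|x| <= r - 1)%R%:R + (r - 1) * (r - 1 < `|x|)%R%:R <= `|f x| /\
        `|f x| <= `|x| * (`|x| <= r)%R%:R + r * (r < `|x|)%R%:R
    & f x @[x --> +oo] --> p +oo%E /\ f x @[x --> -oo] --> p -oo%E].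

(* Generalised inverse of a distribution function, with values in
   [-oo, +oo]; in particular [quantile F 0 = -oo]. *)
Definition quantile (R : realType) (F : R -> \bar R) (t : R) : \bar R :=
  ereal_inf [set x%:E | x in [set x : R | (t%:E <= F x)%E]].

Definition box0 (R : realType) (d : nat) (u : 'rV[R]_d) : set 'rV[R]_d :=
  [set x | forall j, 0 <= x 0 j < u 0 j].

(* [\prod_j u 0 j] is the Lebesgue measure of [box0 u]. *)
Definition star_discrepancy (R : realType) (d n : nat)
    (y : 'I_n -> 'rV[R]_d) : \bar R :=
  ereal_sup
    [set (`| n%:R^-1 * (\sum_(i < n) \1_(box0 u) (y i)) - \prod_(j < d) u 0 j |)%:E
    | u in [set u : 'rV[R]_d | forall j, 0 <= u 0 j <= 1]].

Definition rvec (R : realType) (dO : measure_display) (O : measurableType dO)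
    (P : probability O R) (d : nat) (X : 'I_d -> {RV P >-> R}) (w : O) :
    'rV[R]_d := \row_j X j w.

(* Subfamilies are covered by taking [A j = setT]. *)
Definition mutually_independent (R : realType) (dO : measure_display)
    (O : measurableType dO) (P : probability O R) (d : nat)
    (X : 'I_d -> {RV P >-> R}) : Prop :=
  forall A : 'I_d -> set R, (forall j, measurable (A j)) ->
    P (\bigcap_(j in [set: 'I_d]) (X j @^-1` A j)) =
    (\prod_(j < d) P (X j @^-1` A j))%E.

Definition std_normal_vector (R : realType) (dO : measure_display)
    (O : measurableType dO) (P : probability O R) (d : nat)
    (W : 'I_d -> {RV P >-> R}) : Prop :=
  mutually_independent W /\
  forall (j : 'I_d) (A : set R), measurable A ->
    distribution P (W j) A = normal_prob 0 1 A.

Definition std_normal_density (R : realType) (d : nat) (x : 'rV[R]_d) : R :=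
  \prod_(j < d) normal_pdf 0 1 (x 0 j).

Definition has_density (R : realType) (dO : measure_display)
    (O : measurableType dO) (P : probability O R) (X : {RV P >-> R})
    (g : R -> R) : Prop :=
  [/\ measurable_fun setT g, forall x, 0 <= g x
    & forall A : set R, measurable A ->
        distribution P X A = (\int[lebesgue_measure]_(x in A) (g x)%:E)%E].

Definition prod_density (R : realType) (d : nat) (g : 'I_d -> R -> R)
    (x : 'rV[R]_d) : R := \prod_(j < d) g j (x 0 j).

Definition h_IS (R : realType) (d : nat) (g : 'I_d -> R -> R)
    (h : 'rV[R]_d -> R) (x : 'rV[R]_d) : R :=
  std_normal_density x * h x / prod_density g x.

Definition proj_estimator (R : realType) (d n : nat) (p : \bar R -> R)
    (Finv : 'I_d -> R -> \bar R) (y : 'I_n -> 'rV[R]_d) (f : 'rV[R]_d -> R) : R :=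
  n%:R^-1 * \sum_(i < n) f (\row_j p (Finv j (y i 0 j))).

(* [prod_density g x = 0 -> h x = 0] makes the quotient h / g meaningful: it is
   void when g > 0, and otherwise it is what importance sampling needs for
   E h(W) = E h_IS(tau), the quotient being read as 0 where g vanishes. *)
Definition IS_errors (R : realType) (d n : nat) (M B A : R)
    (dO : measure_display) (O : measurableType dO) (P : probability O R)
    (W : 'I_d -> {RV P >-> R}) (p : \bar R -> R) (y : 'I_n -> 'rV[R]_d) :
    set (\bar R) :=
  [set e | exists (dT : measure_display) (T : measurableType dT)
      (Q : probability T R) (tau : 'I_d -> {RV Q >-> R}) (g : 'I_d -> R -> R)
      (h : 'rV[R]_d -> R),
    [/\ mutually_independent tau,
        forall j, has_density (tau j) (g j),
        ('E_Q[fun w => (enorm (rvec tau w) ^+ 2)%R] <= A%:E)%E,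
        (forall x, prod_density g x = 0 -> h x = 0) /\
        Ge2 M B (fun x => h x / prod_density g x)
      & e = `| (proj_estimator p (fun j => quantile (cdf (tau j))) y
                  (h_IS g h))%:E
               - 'E_P[fun w => h (rvec W w)] |%E ]].

(* Main.v *)
Require Import Defs.
From HB Require Import structures.
From mathcomp Require Import all_boot all_order all_algebra.
From mathcomp Require Import all_classical all_reals all_analysis.
From mathcomp Require Import measurable_realfun.
From mathcomp Require Import ring lra.
Set Implicit Arguments.
Unset Strict Implicit.
Unset Printing Implicit Defensive.
Import Order.TTheory GRing.Theory Num.Theory.
Import numFieldNormedType.Exports.
Local Open Scope classical_set_scope.
Local Open Scope ring_scope.

(** Put f = h / g, a = 1/2 - M and H = phi f, where phi is the density of W, so
that h_IS = H. Differentiating a one-dimensional factor of phi only costs a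
factor |x_j|, and |d^u f| <= B exp(M |x|^2); hence every mixed partial
derivative of H is bounded by a constant K0 depending on d, M, B
([std_normal_density_mpartials_le]), and |H(x)| <= B exp(-a l^2) as soon as
one |x_j| >= l ([std_normal_density_tail]). As a (R-1)^2 = ln n, replacing H
by its composition with P_R changes it by at most 2B/n everywhere
([truncation_error]).

What remains is a Koksma-Hlawka estimate for the composition of H, P_R and
F^-1, whose variation is that of H on a cube of side 2R. It is carried out
on a grid of mesh 2R/N, which avoids multiple integrals: rounding every
coordinate up to the grid turns H o P_R into a step function, at a cost of
order R/N ([projection_cell], [mpartials_le_lipschitz]), and summation by
parts in each coordinate writes the step function as a combination of
indicators of orthants [x_j <= t_j for all j] ([abel_expand]). The
coefficients are mixed increments of H between consecutive values of P_R on
the grid, so that their absolute values add up to at most K0 (1 + 2R)^d,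
whatever N is ([abel_bound]). For one orthant, F_j^-1(y) <= t is equivalent
to y <= F_j(t) ([quantile_le]), so the error of the sample mean is the local
discrepancy of a closed box with upper corner (F_j(t_j))_j, which is at most
2 D + d/n ([closed_box_discrepancy]).

The expectation E h(W) is compared with the same orthants without leaving
the probability space of W: h(W) = H(W) rho with the likelihood ratio
rho = prod_j g_j(W_j) / phi(W_j), and by independence of the W_j the weight
rho gives the orthant the mass prod_j F_j(t_j) ([expectation_density_ratio]).
A uniform approximation of H by eta then changes the expectation by at most
eta, since E rho = 1 ([expectation_approx]).

Altogether the error is O((1 + 2R)^d (ln n)^(d-1) / n) with R of order
(ln n)^(1/2), which is the rate claimed. *)

(** * Mixed partial derivatives and increments *)

Definition upd (R : realType) (d : nat) (x : 'rV[R]_d) (j : 'I_d) (a : R) :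
  'rV[R]_d := \row_i (if i == j then a else x 0 i).

Lemma updE (R : realType) (d : nat) (x : 'rV[R]_d) (j : 'I_d) (a : R) i :
  upd x j a 0 i = if i == j then a else x 0 i.
Proof. by rewrite mxE. Qed.

Lemma upd_id (R : realType) (d : nat) (x : 'rV[R]_d) (j : 'I_d) :
  upd x j (x 0 j) = x.
Proof. by apply/rowP => i; rewrite updE; case: eqP => // ->. Qed.

Lemma upd_shift (R : realType) (d : nat) (x : 'rV[R]_d) (j : 'I_d) (a h : R) :
  h *: delta_mx 0 j + upd x j a = upd x j (h + a).
Proof.
apply/rowP => i; rewrite !mxE eqxx /=.
by case: eqP => _; rewrite ?mulr1 ?mulr0 ?add0r.
Qed.

Lemma updC (R : realType) (d : nat) (x : 'rV[R]_d) (i j : 'I_d) (a b : R) :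
  i != j -> upd (upd x i a) j b = upd (upd x j b) i a.
Proof.
move=> ij; apply/rowP => k; rewrite !updE.
by case: (k =P j) => [->|//]; rewrite eq_sym (negPf ij).
Qed.

(** Partial derivatives are derivatives of one-variable slices; this carries
one-variable calculus (mean value theorem, chain rule) over to ['D_e_j]. *)
Lemma is_derive_slice (R : realType) (d : nat) (f : 'rV[R]_d -> R)
    (x : 'rV[R]_d) (j : 'I_d) (a df : R) :
  is_derive (upd x j a) (delta_mx 0 j) f df <->
  is_derive a 1 (fun s => f (upd x j s)) df.
Proof.
have E : (fun h : R => h^-1 *: ((f \o shift (upd x j a)) (h *: delta_mx 0 j)
            - f (upd x j a))) =
    (fun h => h^-1 *: (((fun s => f (upd x j s)) \o shift a) (h *: 1)
            - f (upd x j a))).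
  apply/funext => h /=; rewrite upd_shift.
  congr (_ *: (f (upd _ _ (_ + _)) - _)).
  by rewrite /GRing.scale/= mulr1.
split=> -[]; rewrite /derivable /derive => h1 h2; split.
- by rewrite /derivable -E.
- by rewrite /derive -E.
- by rewrite /derivable E.
- by rewrite /derive E.
Qed.

Lemma ler_lipschitz (R : realType) (f : R -> R) (K : R) :
  (forall x, derivable f x 1) -> (forall x, `|'D_1 f x| <= K) ->
  forall a b, `|f a - f b| <= K * `|a - b|.
Proof.
move=> df fK a b; wlog ab : a b / a <= b => [H|].
  case: (leP a b) => [ab|/ltW ba]; first exact: H.
  by rewrite distrC [X in _ <= _ * X]distrC; exact: H.
have [c _ E] : exists2 c, c \in `[a, b]%R & f b - f a = 'D_1 f c * (b - a).
  have cf : {within `[a, b], continuous f}.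
    by apply: derivable_within_continuous => x _; exact: df.
  by apply: MVT_segment => // x _; exact/derivableP/df.
by rewrite distrC E normrM [X in _ <= _ * X]distrC ler_wpM2r.
Qed.

Lemma ler_lipschitz_upd (R : realType) (d : nat) (f : 'rV[R]_d -> R) (K : R)
    (j : 'I_d) :
  (forall x, derivable f x (delta_mx 0 j)) ->
  (forall x, `|'D_(delta_mx 0 j) f x| <= K) ->
  forall x a b, `|f (upd x j a) - f (upd x j b)| <= K * `|a - b|.
Proof.
move=> df fK x a b.
have H s := proj1 (is_derive_slice _ _ _ _ _) (derivableP (df (upd x j s))).
apply: (@ler_lipschitz _ (fun s => f (upd x j s))) => s.
  exact: (@ex_derive _ _ _ _ _ _ _ (H s)).
by rewrite (@derive_val _ _ _ _ _ _ _ (H s)).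
Qed.

(** All mixed derivatives along subsequences of [s], taken in the order of [s],
exist and are dominated by the weight [w]. The order matters: since
[mpartial (j :: v) f] is the derivative of [mpartial v f] in the coordinate [j],
it controls the increments of [mpartial v f] in that coordinate. *)
Definition mpartials_le (R : realType) (d : nat) (s : seq 'I_d)
    (f w : 'rV[R]_d -> R) :=
  forall v, subseq v s ->
    ex_mpartial v f /\ forall x, `|mpartial v f x| <= w x.

Lemma mpartials_le_sub (R : realType) (d : nat) (s s' : seq 'I_d)
    (f w : 'rV[R]_d -> R) :
  subseq s' s -> mpartials_le s f w -> mpartials_le s' f w.
Proof. by move=> ss' n v vs; apply: n; exact: subseq_trans ss'. Qed.

Lemma mpartial_upd (R : realType) (d : nat) (f : 'rV[R]_d -> R) (j : 'I_d)
    (a : R) (v : seq 'I_d) :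
  j \notin v -> ex_mpartial v f ->
  ex_mpartial v (fun x => f (upd x j a)) /\
  mpartial v (fun x => f (upd x j a)) = (fun x => mpartial v f (upd x j a)).
Proof.
elim: v => [//|i v ih]; rewrite inE negb_or => /andP[ji jv] /= [exv di].
have [ex E] := ih jv exv; rewrite E.
have H x : is_derive x (delta_mx 0 i) (fun x => mpartial v f (upd x j a))
    ('D_(delta_mx 0 i) (mpartial v f) (upd x j a)).
  rewrite -{1}(upd_id x i); apply/is_derive_slice.
  under eq_fun do rewrite updC 1?eq_sym//.
  apply/is_derive_slice; rewrite updC// upd_id.
  exact/derivableP.
split; last by apply/funext => x; exact: derive_val.
by split=> // x; exact: (@ex_derive _ _ _ _ _ _ _ (H x)).
Qed.

Lemma mpartialB (R : realType) (d : nat) (f g : 'rV[R]_d -> R)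
    (v : seq 'I_d) :
  ex_mpartial v f -> ex_mpartial v g ->
  ex_mpartial v (fun x => f x - g x) /\
  mpartial v (fun x => f x - g x) = (fun x => mpartial v f x - mpartial v g x).
Proof.
elim: v => [//|i v ih] /= [exf df] [exg dg].
have [ex E] := ih exf exg; rewrite E.
have H x : is_derive x (delta_mx 0 i) (mpartial v f - mpartial v g)
    ('D_(delta_mx 0 i) (mpartial v f) x - 'D_(delta_mx 0 i) (mpartial v g) x).
  by apply: is_deriveB; exact: derivableP.
split; last by apply/funext => x; exact: derive_val.
by split=> // x; exact: (@ex_derive _ _ _ _ _ _ _ (H x)).
Qed.

Lemma mpartials_le_upd (R : realType) (d : nat) (f : 'rV[R]_d -> R) (K a : R)
    (j : 'I_d) (s : seq 'I_d) :
  j \notin s -> mpartials_le s f (cst K) ->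
  mpartials_le s (fun x => f (upd x j a)) (cst K).
Proof.
move=> js n v vs; have [exv b] := n v vs.
have jv : j \notin v by apply: contra js; exact: mem_subseq.
by have [? E] := mpartial_upd a jv exv; split=> // x; rewrite E; exact: b.
Qed.

(** An increment in the coordinate [j] trades the derivative in [j] for the
factor [|a - b|]: the mean value theorem is applied to each [mpartial v f],
whose derivative in [j] is [mpartial (j :: v) f]. Iterating over the
coordinates bounds mixed increments by products of edge lengths. *)
Lemma mpartials_le_updB (R : realType) (d : nat) (f : 'rV[R]_d -> R) (K a b : R)
    (j : 'I_d) (s : seq 'I_d) :
  j \notin s -> mpartials_le (j :: s) f (cst K) ->
  mpartials_le s (fun x => f (upd x j a) - f (upd x j b)) (cst (K * `|a - b|)).
Proof.
move=> js n v vs.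
have [exv bv] := n v (subseq_trans vs (subseq_cons _ _)).
have [|[_ djv] bjv] := n (j :: v); first by rewrite /= eqxx.
have jv : j \notin v by apply: contra js; exact: mem_subseq.
have [exa Ea] := mpartial_upd a jv exv.
have [exb Eb] := mpartial_upd b jv exv.
have [ex E] := mpartialB exa exb; split => // x.
by rewrite E Ea Eb; exact: ler_lipschitz_upd.
Qed.

(** Leibniz rule for a factor depending on a single coordinate. As [v] has no
repetition, at most one derivative hits the factor, so there are only two
terms; products over all coordinates are reached one factor at a time. *)
Lemma mpartial_mul_coord (R : realType) (d : nat) (f : 'rV[R]_d -> R)
    (th th' : R -> R) (j : 'I_d) (v : seq 'I_d) :
  (forall t : R, is_derive t 1 th (th' t)) -> uniq v ->
  (forall u, subseq u v -> ex_mpartial u f) ->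
  ex_mpartial v (fun x => th (x 0 j) * f x) /\
  mpartial v (fun x => th (x 0 j) * f x) =
    (fun x => th (x 0 j) * mpartial v f x +
              (j \in v)%:R * (th' (x 0 j) * mpartial (rem j v) f x)).
Proof.
move=> dth; elim: v => [_ _|i v ih uiv exf].
  by split=> //; apply/funext => x /=; rewrite mul0r addr0.
have /andP[iv uv] := uiv; rewrite /=.
have exv u : subseq u v -> ex_mpartial u f.
  by move=> uv'; apply: exf; exact: subseq_trans uv' (subseq_cons _ _).
have [ex E] := ih uv exv; rewrite E.
have [/= _ div] := exf (i :: v) (subseq_refl _).
pose th1 (x : 'rV[R]_d) := th (x 0 j).
pose th1' (x : 'rV[R]_d) := th' (x 0 j).
suff H x : is_derive x (delta_mx 0 i)
    (fun x => th (x 0 j) * mpartial v f x +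
              (j \in v)%:R * (th' (x 0 j) * mpartial (rem j v) f x))
    (th (x 0 j) * 'D_(delta_mx 0 i) (mpartial v f) x +
     (j \in i :: v)%:R * (th' (x 0 j) * mpartial (rem j (i :: v)) f x)).
  split; last by apply/funext => x; exact: derive_val.
  by split=> // x; exact: (@ex_derive _ _ _ _ _ _ _ (H x)).
have Hv : is_derive x (delta_mx 0 i) (mpartial v f)
    ('D_(delta_mx 0 i) (mpartial v f) x) by exact/derivableP.
have [ij|ij] := eqVneq i j.
  subst i; rewrite inE eqxx /= (negPf iv) eqxx mul1r.
  under [X in is_derive _ _ X]eq_fun do rewrite mul0r addr0.
  have H1 : is_derive x (delta_mx 0 j) th1 (th1' x).
    rewrite -{1}(upd_id x j); apply/is_derive_slice.
    rewrite /th1'.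
    by under eq_fun do rewrite /th1 updE eqxx; exact: dth.
  apply: (is_derive_eq (is_deriveM H1 Hv)).
  by rewrite /th1 /th1' /GRing.scale/= [X in _ + X]mulrC.
rewrite inE eq_sym (negPf ij) /=.
have cst0 (g : R -> R) :
    is_derive x (delta_mx 0 i) (fun y : 'rV[R]_d => g (y 0 j)) 0.
  rewrite -{1}(upd_id x i); apply/is_derive_slice.
  under eq_fun do rewrite updE eq_sym (negPf ij).
  exact: is_derive_cst.
have H1 := is_deriveM (cst0 th) Hv.
have [jv|jv] := boolP (j \in v); last first.
  under [X in is_derive _ _ X]eq_fun do rewrite mul0r addr0.
  apply: (is_derive_eq H1).
  by rewrite scaler0 addr0 mul0r addr0.
have [|/= _ dir] := exf (i :: rem j v).
  by rewrite /= eqxx; exact: rem_subseq.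
have Hr : is_derive x (delta_mx 0 i) (mpartial (rem j v) f)
    ('D_(delta_mx 0 i) (mpartial (rem j v) f) x) by exact/derivableP.
have H2 := is_deriveM (cst0 th') Hr.
under [X in is_derive _ _ X]eq_fun do rewrite mul1r.
apply: (is_derive_eq (is_deriveD H1 H2)).
by rewrite !scaler0 !addr0 mul1r (negPf ij).
Qed.

Lemma mpartials_le_mul_coord (R : realType) (d : nat) (f w : 'rV[R]_d -> R)
    (th th' : R -> R) (j : 'I_d) (s : seq 'I_d) :
  (forall t : R, is_derive t 1 th (th' t)) -> uniq s -> mpartials_le s f w ->
  mpartials_le s (fun x => th (x 0 j) * f x)
    (fun x => (`|th (x 0 j)| + `|th' (x 0 j)|) * w x).
Proof.
move=> dth us n v vs.
have [||ex E] := @mpartial_mul_coord _ _ f _ _ j v dth.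
- exact: subseq_uniq us.
- by move=> u uv; apply: (n u _).1; exact: subseq_trans vs.
split=> // x; rewrite E; apply: (le_trans (ler_normD _ _)).
rewrite mulrDl; apply: lerD; rewrite !normrM.
  by rewrite ler_wpM2l//; exact: (n v _).2.
have h2 : `|th' (x 0 j)| * `|mpartial (rem j v) f x| <= `|th' (x 0 j)| * w x.
  rewrite ler_wpM2l//; apply: (n _ _).2.
  exact: subseq_trans (rem_subseq _ _) vs.
apply: le_trans h2; rewrite ler_piMl ?mulr_ge0//.
by case: (j \in v); rewrite ?normr0 ?normr1 ?ler01.
Qed.

Lemma mpartials_le_mul_prod (R : realType) (d : nat) (f w : 'rV[R]_d -> R)
    (th th' : R -> R) (s t : seq 'I_d) :
  (forall t : R, is_derive t 1 th (th' t)) -> uniq s -> mpartials_le s f w ->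
  mpartials_le s (fun x => (\prod_(j <- t) th (x 0 j)) * f x)
    (fun x => (\prod_(j <- t) (`|th (x 0 j)| + `|th' (x 0 j)|)) * w x).
Proof.
move=> dth us n; elim: t => [|j t ih].
  move: n; congr (mpartials_le s _ _); apply/funext => x;
    by rewrite big_nil mul1r.
have := mpartials_le_mul_coord j dth us ih.
by congr (mpartials_le s _ _); apply/funext => x; rewrite big_cons mulrA.
Qed.

(** * Summation by parts on a grid *)

(** The value beyond the last node [v N] is read as 0, so that the plain value
at [v N] is one of the differences. *)
Definition node_diff (R : realType) (d N : nat) (v : nat -> R)
    (f : 'rV[R]_d -> R) (j : 'I_d) (k : nat) (x : 'rV[R]_d) : R :=
  f (upd x j (v k)) - (if (k < N)%N then f (upd x j (v k.+1)) else 0).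

(** Coefficients of the tensor product of one-variable Abel summations: an
entry [(a, k)] stands for [a] times the indicator of the indices [m] with
[m j <= k j] for all [j] in [s]. Components of [k] outside [s] are dummies. *)
Fixpoint abel (R : realType) (d N : nat) (v : nat -> R) (s : seq 'I_d)
    (f : 'rV[R]_d -> R) : seq (R * ('I_d -> 'I_N.+1)) :=
  if s is j :: s' then
    flatten [seq [seq (c.1, fun i : 'I_d => if i == j then k else c.2 i)
                 | c <- abel N v s' (node_diff N v f j k)]
            | k : 'I_N.+1 <- enum 'I_N.+1]
  else [:: (f 0, fun=> ord_max)].

Lemma node_diff_telescope (R : realType) (N : nat) (phi : nat -> R)
    (m : 'I_N.+1) :
  \sum_(k < N.+1) (phi k - (if (k < N)%N then phi k.+1 else 0))
      * (m <= k)%N%:R = phi m.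
Proof.
pose psi k := if (k <= N)%N then phi k else 0.
have mN : (m <= N.+1)%N by exact/ltnW/ltn_ord.
rewrite -(big_mkord predT (fun k =>
  (phi k - (if (k < N)%N then phi k.+1 else 0)) * (m <= k)%N%:R)).
rewrite (big_cat_nat (leq0n m) mN)//= big_nat big1 ?add0r; last first.
  by move=> k /= km; rewrite (leqNgt m k) km mulr0.
transitivity (\sum_(m <= k < N.+1) (- psi k.+1 - - psi k)).
  apply: eq_big_nat => k /andP[mk kN]; rewrite mk mulr1 /psi.
  have -> : (k <= N)%N by rewrite -ltnS.
  by rewrite opprK addrC.
rewrite telescope_sumr//.
have mN' : (m <= N)%N by rewrite -ltnS.
by rewrite /psi ltnn mN' oppr0 sub0r opprK.
Qed.

Lemma abel_expand (R : realType) (d N : nat) (v : nat -> R) (s : seq 'I_d)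
    (f : 'rV[R]_d -> R) (m : 'I_d -> 'I_N.+1) :
  uniq s ->
  \sum_(c <- abel N v s f) c.1 * \prod_(j <- s) (m j <= c.2 j)%N%:R =
  f (\row_j (if j \in s then v (m j) else 0)).
Proof.
elim: s f => [|j s ih] f /=.
  move=> _; rewrite big_seq1 big_nil mulr1; congr f.
  by apply/rowP => i; rewrite !mxE.
move=> /andP[js us]; rewrite big_flatten big_map.
set z := \row_i (if i \in s then v (m i) else 0).
transitivity (\sum_(k <- enum 'I_N.+1) node_diff N v f j k z * (m j <= k)%N%:R).
  apply: eq_bigr => k _; rewrite big_map -ih// mulr_suml.
  apply: eq_bigr => c _; rewrite big_cons /= eqxx -mulrA; congr (_ * _).
  rewrite mulrC; congr (_ * _); rewrite big_seq [in RHS]big_seq.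
  apply: eq_bigr => i si; case: eqP => // ij.
  by move: js; rewrite -ij si.
rewrite big_enum/= (node_diff_telescope (fun k => f (upd z j (v k)))).
congr f; apply/rowP => i; rewrite !mxE inE.
by case: eqP => // ->.
Qed.

(** In each coordinate there are [N] increments, each worth [h], and one
boundary value, whence the factor [1 + N h], which stays bounded when the mesh
[h] is of order [1 / N]. *)
Lemma abel_bound (R : realType) (d N : nat) (v : nat -> R) (s : seq 'I_d)
    (f : 'rV[R]_d -> R) (K h : R) :
  (forall k, (k < N)%N -> `|v k - v k.+1| <= h) -> 0 <= h -> 0 <= K ->
  uniq s -> mpartials_le s f (cst K) ->
  \sum_(c <- abel N v s f) `|c.1| <= K * (1 + N%:R * h) ^+ size s.
Proof.
move=> vh h0; elim: s f K => [|j s ih] f K K0 /=.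
  by move=> _ n; rewrite big_seq1 expr0 mulr1; apply: (n [::] _).2.
move=> /andP[js us] n; rewrite big_flatten big_map big_enum/=.
under eq_bigr do rewrite big_map.
rewrite big_ord_recr/= exprS mulrA mulrDr mulr1 [leRHS]mulrDl addrC.
apply: lerD.
  apply: ih => //; rewrite /node_diff ltnn.
  under eq_fun do rewrite subr0.
  apply: mpartials_le_upd => //.
  by apply: mpartials_le_sub n; exact: subseq_cons.
rewrite mulrCA -mulrA.
apply: (@le_trans _ _ (\sum_(k < N) ((K * h) * (1 + N%:R * h) ^+ size s))).
  apply: ler_sum => k _; apply: ih => //; first exact: mulr_ge0.
  have := @mpartials_le_updB _ _ f K (v k) (v k.+1) j s js n.
  rewrite /node_diff ltn_ord => nk u us'; have [ex b] := nk u us'.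
  split=> // x; apply: (le_trans (b x)) => /=.
  by rewrite ler_wpM2l// vh.
by rewrite sumr_const card_ord [leRHS]mulr_natl.
Qed.

(** * Gaussian estimates *)

Local Notation phi := (normal_pdf 0 1).

Lemma std_normal_pdfE (R : realType) (x : R) :
  phi x = normal_peak 1 * expR (- x ^+ 2 / 2).
Proof. by rewrite normal_pdfE ?oner_eq0// /normal_fun subr0 expr1n. Qed.

Lemma std_normal_pdf_gt0 (R : realType) (x : R) : 0 < phi x.
Proof.
by rewrite std_normal_pdfE mulr_gt0 ?expR_gt0// normal_peak_gt0 ?oner_eq0.
Qed.

Lemma is_derive_std_normal_pdf (R : realType) (t : R) :
  is_derive t 1 phi (- t * phi t).
Proof.
have -> : phi = normal_peak 1 \*: (expR \o (fun x : R => - x ^+ 2 / 2)).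
  by apply/funext => x; rewrite std_normal_pdfE.
have H : is_derive t 1 (fun x : R => - x ^+ 2 / 2) (- t).
  have -> : (fun x : R => - x ^+ 2 / 2) = (- 2^-1) \*: (id ^+ 2 : R -> R).
    by apply/funext => x /=; rewrite /GRing.scale/= !mulNr mulrC.
  apply: is_derive_eq; rewrite /= expr1 /GRing.scale/= mulr1.
  by field.
have H2 := is_derive1_comp (is_derive_expR _) H.
apply: (is_derive_eq (is_deriveZ _ H2)).
by rewrite /GRing.scale/= /GRing.scale/=; ring.
Qed.

Lemma std_normal_peak_le1 (R : realType) : normal_peak (1 : R) <= 1.
Proof.
have p2 : 1 <= pi *+ 2 :> R.
  by have := @pi_ge2 R; rewrite mulr2n; lra.
rewrite /normal_peak expr1n mul1r invf_le1.
  by rewrite -[leLHS]sqrtr1 ler_sqrt// (le_trans ler01).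
by rewrite sqrtr_gt0 (lt_le_trans ltr01).
Qed.

Lemma std_normal_pdf_expR (R : realType) (M x : R) :
  phi x * expR (M * x ^+ 2) <= expR (- (1 / 2 - M) * x ^+ 2).
Proof.
rewrite std_normal_pdfE -mulrA -expRD.
have -> : - x ^+ 2 / 2 + M * x ^+ 2 = - (1 / 2 - M) * x ^+ 2 by field.
by rewrite ler_piMl ?expR_ge0// std_normal_peak_le1.
Qed.

(** [1 + |x| <= 2 + x^2 <= (2 + 1/a) (1 + a x^2) <= (2 + 1/a) exp(a x^2)]
with [a = 1/2 - M]. *)
Lemma std_normal_pdf_deriv_bound (R : realType) (M x : R) : M < 1 / 2 ->
  (`|phi x| + `|- x * phi x|) * expR (M * x ^+ 2) <= 2 + (1 / 2 - M)^-1.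
Proof.
move=> M2; set a := 1 / 2 - M; have a0 : 0 < a by rewrite /a; lra.
rewrite normrM normrN (gtr0_norm (std_normal_pdf_gt0 x)) -{1}[phi x]mul1r.
rewrite -mulrDl -mulrA.
have x0 : 0 <= x ^+ 2 by exact: sqr_ge0.
apply: (@le_trans _ _ ((2 + x ^+ 2) * expR (- a * x ^+ 2))).
  have h1 : 1 + `|x| <= 2 + x ^+ 2.
    have : 0 <= (`|x| - 1) ^+ 2 by exact: sqr_ge0.
    rewrite sqrrB1 -normrX ger0_norm// => h.
    by have := normr_ge0 x; rewrite mulr2n in h; lra.
  have h2 := std_normal_pdf_expR M x.
  apply: ler_pM => //.
  by rewrite mulr_ge0 ?expR_ge0// ltW ?std_normal_pdf_gt0.
rewrite mulNr expRN ler_pdivrMr ?expR_gt0//.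
have h : 1 + a * x ^+ 2 <= expR (a * x ^+ 2) by exact: expR_ge1Dx.
apply: (@le_trans _ _ ((2 + a^-1) * (1 + a * x ^+ 2))).
  have -> : (2 + a^-1) * (1 + a * x ^+ 2) =
      2 + 2 * (a * x ^+ 2) + a^-1 + x ^+ 2 by field; rewrite gt_eqF.
  have : 0 < a^-1 by rewrite invr_gt0.
  have : 0 <= a * x ^+ 2 by rewrite mulr_ge0// ltW.
  lra.
by rewrite ler_wpM2l// addr_ge0// invr_ge0 ltW.
Qed.

Lemma enorm_sqr (R : realType) (d : nat) (x : 'rV[R]_d) :
  enorm x ^+ 2 = \sum_(j < d) x 0 j ^+ 2.
Proof. by rewrite sqr_sqrtr// sumr_ge0// => j _; exact: sqr_ge0. Qed.

(** A subsequence of [enum 'I_d] is the enumeration of the set of its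
elements, so the derivatives along subsequences are those indexed by sets. *)
Lemma Ge2_mpartials_le (R : realType) (d : nat) (M B : R) (f : 'rV[R]_d -> R) :
  Ge2 M B f ->
  mpartials_le (enum 'I_d) f (fun x => B * expR (M * enorm x ^+ 2)).
Proof.
move=> [Sf bf] v vs.
have vE : v = enum [set i in v].
  rewrite {1}(subseq_uniqP (enum_uniq _) vs) enumT /enum_mem.
  by apply: eq_filter => i; rewrite /= inE.
by rewrite vE; split; [exact: (Sf _).1|exact: bf].
Qed.

Definition mixed_bound (R : realType) (d : nat) (M B : R) : R :=
  (2 + (1 / 2 - M)^-1) ^+ d * B.

Lemma mixed_bound_ge0 (R : realType) (d : nat) (M B : R) :
  M < 1 / 2 -> 0 < B -> 0 <= mixed_bound d M B.
Proof.
move=> M2 B0; rewrite mulr_ge0 ?exprn_ge0//; last exact: ltW.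
by rewrite addr_ge0// invr_ge0 ltW// subr_gt0.
Qed.

Lemma expR_enorm (R : realType) (d : nat) (M : R) (x : 'rV[R]_d) :
  expR (M * enorm x ^+ 2) = \prod_(j < d) expR (M * x 0 j ^+ 2).
Proof. by rewrite enorm_sqr mulr_sumr expR_sum. Qed.

(** Both the density and the growth bound factor over the coordinates, and
each coordinate contributes [2 + 1 / (1/2 - M)] at most. *)
Lemma std_normal_density_mpartials_le (R : realType) (d : nat) (M B : R)
    (f : 'rV[R]_d -> R) :
  M < 1 / 2 -> 0 < B -> Ge2 M B f ->
  mpartials_le (enum 'I_d) (fun x => std_normal_density x * f x)
    (cst (mixed_bound d M B)).
Proof.
move=> M2 B0 fG.
have bigE F : \prod_(j <- enum 'I_d) F j = \prod_(j < d) F j :> R.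
  by rewrite big_enum.
have := mpartials_le_mul_prod (enum 'I_d) (@is_derive_std_normal_pdf R)
  (enum_uniq 'I_d) (Ge2_mpartials_le fG).
under eq_fun do rewrite bigE.
move=> n v vs; have [ex bd] := n v vs; split => // x.
apply: (le_trans (bd x)); rewrite bigE expR_enorm mulrCA mulrC.
rewrite /mixed_bound ler_wpM2r//; first exact: ltW.
rewrite -big_split/=.
have -> : (2 + (1 / 2 - M)^-1) ^+ d = \prod_(j < d) (2 + (1 / 2 - M)^-1).
  by rewrite prodr_const card_ord.
apply: ler_prod => j _; rewrite mulr_ge0 ?addr_ge0 ?expR_ge0//=.
exact: std_normal_pdf_deriv_bound.
Qed.

(** The coordinate [j] alone provides the decay; the others contribute factors
at most 1. *)
Lemma std_normal_density_tail (R : realType) (d : nat) (M B : R)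
    (f : 'rV[R]_d -> R) (x : 'rV[R]_d) (j : 'I_d) (l : R) :
  M < 1 / 2 -> 0 < B -> Ge2 M B f ->
  0 <= l -> l <= `|x 0 j| ->
  `|std_normal_density x * f x| <= B * expR (- (1 / 2 - M) * l ^+ 2).
Proof.
move=> M2 B0 fG l0 lx; rewrite normrM ger0_norm; last first.
  by apply: prodr_ge0 => i _; exact/ltW/std_normal_pdf_gt0.
have := fG.2 (finset.set0 : {set _}) x; rewrite /dmixed enum_set0/= => bf.
apply: (@le_trans _ _ (std_normal_density x * (B * expR (M * enorm x ^+ 2)))).
  rewrite ler_wpM2l//; apply: prodr_ge0 => i _; exact/ltW/std_normal_pdf_gt0.
rewrite mulrCA ler_wpM2l//; first exact: ltW.
rewrite expR_enorm -big_split/=.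
have a0 : 0 < 1 / 2 - M by rewrite subr_gt0.
rewrite (bigD1 j)//= -[leRHS]mulr1; apply: ler_pM.
- by rewrite mulr_ge0 ?expR_ge0// ltW ?std_normal_pdf_gt0.
- apply: prodr_ge0 => i _.
  by rewrite mulr_ge0 ?expR_ge0// ltW ?std_normal_pdf_gt0.
- apply: (le_trans (std_normal_pdf_expR _ _)); rewrite ler_expR !mulNr lerN2.
  rewrite ler_wpM2l//; first exact: ltW.
  rewrite -[leRHS]ger0_norm ?sqr_ge0// normrX.
  by rewrite lerXn2r ?nnegrE.
- apply: prodr_ile1 => i _.
  rewrite mulr_ge0 ?expR_ge0 ?(ltW (std_normal_pdf_gt0 _))//=.
  apply: (le_trans (std_normal_pdf_expR _ _)).
  by rewrite -[leRHS]expR0 ler_expR mulNr oppr_le0 mulr_ge0 ?sqr_ge0// ltW.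
Qed.

(** The coordinates are changed one by one from [x] to [y]. *)
Lemma mpartials_le_lipschitz (R : realType) (d : nat) (F : 'rV[R]_d -> R)
    (K : R) (x y : 'rV[R]_d) :
  mpartials_le (enum 'I_d) F (cst K) ->
  `|F x - F y| <= K * \sum_(j < d) `|x 0 j - y 0 j|.
Proof.
move=> nF.
pose mix (s : seq 'I_d) : 'rV[R]_d := \row_j if j \in s then y 0 j else x 0 j.
suff H s : uniq s ->
    `|F x - F (mix s)| <= K * \sum_(j <- s) `|x 0 j - y 0 j|.
  have := H _ (enum_uniq 'I_d); rewrite big_enum/=.
  suff -> : mix (enum 'I_d) = y by [].
  by apply/rowP => j; rewrite mxE mem_enum.
elim: s => [_|j s ih /= /andP[js us]].
  suff -> : mix [::] = x by rewrite subrr normr0 big_nil mulr0.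
  by apply/rowP => j; rewrite mxE.
rewrite big_cons mulrDr [leRHS]addrC.
apply: (le_trans (ler_distD (F (mix s)) _ _)); apply: lerD; first exact: ih.
have -> : mix (j :: s) = upd (mix s) j (y 0 j).
  by apply/rowP => i; rewrite !mxE inE; case: eqP => //= ->.
have {1}-> : mix s = upd (mix s) j (x 0 j).
  by apply/rowP => i; rewrite !mxE; case: eqP => // ->; rewrite (negPf js).
have [|[_ dF] bF] := nF [:: j]; first by rewrite sub1seq mem_enum.
exact: ler_lipschitz_upd.
Qed.

(** * Projection and grid *)

(** Rounding up to the nodes [t 0 <= ... <= t N]; everything above [t N.-1]
goes into the last cell. *)
Definition cell (R : realType) (N : nat) (t : nat -> R) (x : \bar R) :
  'I_N.+1 := inord (find (fun k => x <= (t k)%:E)%E (iota 0 N)).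

(** The last cell is unbounded above, and its index imposes no constraint in
[abel]; hence the value [+oo]. *)
Definition node (R : realType) (N : nat) (t : nat -> R) (k : 'I_N.+1) :
  \bar R := if (k < N)%N then (t k)%:E else +oo%E.

(** This turns the index inequalities of [abel_expand] into membership in
orthants. *)
Lemma cell_le (R : realType) (N : nat) (t : nat -> R) (x : \bar R)
    (k : 'I_N.+1) :
  {homo t : a b / (a <= b)%N >-> a <= b} ->
  (cell N t x <= k)%N = (x <= node t k)%E.
Proof.
move=> tmono; set a := fun k => (x <= (t k)%:E)%E.
have fN : (find a (iota 0 N) <= N)%N.
  by have := find_size a (iota 0 N); rewrite size_iota.
rewrite /cell inordK ?ltnS// -/a /node.
case: ifPn => [kN|]; last first.
  by rewrite -leqNgt => Nk; rewrite leey (leq_trans fN).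
apply/idP/idP => [fk|xk].
  have hs : has a (iota 0 N) by rewrite has_find size_iota (leq_ltn_trans fk).
  have := nth_find 0%N hs; rewrite nth_iota ?(leq_ltn_trans fk)// add0n /a.
  by move/le_trans; apply; rewrite lee_fin tmono.
rewrite leqNgt; apply/negP => /(before_find 0%N).
by rewrite nth_iota// add0n /a xk.
Qed.

(** The derivative vanishes on the open half-line beyond [r]. *)
Lemma projection_const_ge (R : realType) (r : R) (p : \bar R -> R) (x : R) :
  is_projection r p -> r <= x -> p x%:E = p r%:E.
Proof.
move=> [_ [dp _] bp _ _]; rewrite le_eqVlt => /predU1P[->//|rx].
have cf : {within `[r, x], continuous (fun x : R => p x%:E)}.
  by apply: derivable_within_continuous => y _; exact: dp.
have [|c crx E] := @MVT _ (fun x : R => p x%:E)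
  ('D_1 (fun x : R => p x%:E)) _ _ rx _ cf.
  by move=> y _; exact/derivableP/dp.
apply/eqP; rewrite -subr_eq0 E.
suff -> : 'D_1 (fun x : R => p x%:E) c = 0 by rewrite mul0r.
move: crx; rewrite in_itv/= => /andP[rc _].
apply/eqP; rewrite -normr_le0 -derive1E; apply: (le_trans (bp c)).
suff -> : (`|c| <= r) = false by [].
by apply/negbTE; rewrite -ltNge (lt_le_trans rc (ler_norm _)).
Qed.

Lemma projection_const_le (R : realType) (r : R) (p : \bar R -> R) (x : R) :
  is_projection r p -> x <= - r -> p x%:E = p (- r)%:E.
Proof.
move=> [_ [dp _] bp _ _]; rewrite le_eqVlt => /predU1P[->//|rx].
have cf : {within `[x, - r], continuous (fun x : R => p x%:E)}.
  by apply: derivable_within_continuous => y _; exact: dp.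
have [|c crx E] := @MVT _ (fun x : R => p x%:E)
  ('D_1 (fun x : R => p x%:E)) _ _ rx _ cf.
  by move=> y _; exact/derivableP/dp.
apply/esym/eqP; rewrite -subr_eq0 E.
suff -> : 'D_1 (fun x : R => p x%:E) c = 0 by rewrite mul0r.
move: crx; rewrite in_itv/= => /andP[_ rc].
apply/eqP; rewrite -normr_le0 -derive1E; apply: (le_trans (bp c)).
suff -> : (`|c| <= r) = false by [].
by apply/negbTE; rewrite -ltNge -normrN (lt_le_trans _ (ler_norm _))// ltrNr.
Qed.

Lemma projection_pinfty (R : realType) (r : R) (p : \bar R -> R) :
  is_projection r p -> p +oo%E = p r%:E.
Proof.
move=> pp; have [_ _ _ _ [cy _]] := pp.
suff cr : p x%:E @[x --> +oo] --> p r%:E by exact: cvg_unique cy cr.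
apply: cvg_near_cst; near=> x; apply: projection_const_ge => //.
Unshelve. all: by end_near. Qed.

Lemma projection_ninfty (R : realType) (r : R) (p : \bar R -> R) :
  is_projection r p -> p -oo%E = p (- r)%:E.
Proof.
move=> pp; have [_ _ _ _ [_ cy]] := pp.
suff cr : p x%:E @[x --> -oo] --> p (- r)%:E by exact: cvg_unique cy cr.
apply: cvg_near_cst; near=> x; apply: projection_const_le => //.
Unshelve. all: by end_near. Qed.

Lemma projection_lipschitz (R : realType) (r : R) (p : \bar R -> R) (x y : R) :
  is_projection r p -> `|p x%:E - p y%:E| <= `|x - y|.
Proof.
move=> [_ [dp _] bp _ _]; rewrite -[leRHS]mul1r.
apply: (@ler_lipschitz _ (fun x => p x%:E)) => // z.
rewrite -derive1E; apply: (le_trans (bp z)).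
by case: (`|z| <= r); rewrite ?ler01.
Qed.

Definition grid (R : realType) (r : R) (N : nat) (k : nat) : R :=
  - r + k%:R * (2 * r / N%:R).

Lemma grid_le (R : realType) (r : R) (N : nat) : 0 <= r ->
  {homo grid r N : a b / (a <= b)%N >-> a <= b}.
Proof.
move=> r0 a b ab; rewrite /grid lerD2l ler_wpM2r// ?ler_nat//.
by rewrite divr_ge0// mulr_ge0.
Qed.

Lemma gridS (R : realType) (r : R) (N k : nat) :
  grid r N k.+1 = grid r N k + 2 * r / N%:R.
Proof. by rewrite /grid -natr1 mulrDl mul1r addrA. Qed.

(** Inside [-r, r] a point and the node it is rounded to are at distance at
most the mesh; outside, the projection is constant and takes its value at an
end of the grid. *)
Lemma projection_cell (R : realType) (r : R) (p : \bar R -> R) (N : nat)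
    (x : \bar R) :
  0 <= r -> (0 < N)%N -> is_projection r p ->
  `|p x - p (grid r N (cell N (grid r N) x))%:E| <= 2 * r / N%:R.
Proof.
move=> r0 N0 pp; set h := 2 * r / N%:R; set k := cell _ _ _.
have N0' : 0 < N%:R :> R by rewrite ltr0n.
have h0 : 0 <= h by rewrite /h divr_ge0// mulr_ge0.
have Nh : N%:R * h = 2 * r by rewrite /h mulrC divfK// gt_eqF.
have tmono := grid_le N r0.
have t0 : grid r N 0 = - r by rewrite /grid mul0r addr0.
have tN : grid r N N = r by rewrite /grid -/h Nh; lra.
have tS m : grid r N m.+1 = grid r N m + h by exact: gridS.
have kN : (k <= N)%N by rewrite -ltnS.
have lo m : (m < k)%N -> ((grid r N m)%:E < x)%E.
  move=> mk; have mN := leq_trans mk kN.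
  rewrite ltNge; apply/negP => xm.
  have := cell_le x (inord m : 'I_N.+1) tmono.
  rewrite /node inordK ?ltnS ?(ltnW mN)// mN xm -/k.
  by rewrite leqNgt mk.
have hi : (k < N)%N -> (x <= (grid r N k)%:E)%E.
  by move=> kN'; have := cell_le x k tmono; rewrite /node kN' leqnn.
case: x k kN lo hi => [x| |] k kN lo hi.
- have [xr|rx] := leP x (- r).
    have k0 : (k = 0 :> nat)%N.
      apply/eqP; rewrite -leqn0 leqNgt; apply/negP => /lo.
      by rewrite t0 lte_fin ltNge xr.
    by rewrite k0 t0 (projection_const_le pp xr) subrr normr0.
  have [[m km]|k0] : (exists m, k = m.+1 :> nat)%N \/ (k = 0 :> nat)%N.
  + by case: (nat_of_ord k) => [|m]; [right|left; exists m].
  + have lom : grid r N m < x by rewrite -lte_fin; apply: lo; rewrite km.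
    have [kN'|] := boolP (k < N)%N.
      apply: (le_trans (projection_lipschitz _ _ pp)).
      have := hi kN'; rewrite lee_fin km tS => hik.
      by rewrite ler_norml; apply/andP; split; lra.
    rewrite -leqNgt => Nk; have {Nk} kE : k = N :> nat.
      by apply/eqP; rewrite eqn_leq kN.
    have [xr|rx'] := leP r x.
      by rewrite kE tN (projection_const_ge pp xr) subrr normr0.
    apply: (le_trans (projection_lipschitz _ _ pp)).
    have := tS m; rewrite -km kE tN => hm.
    by rewrite ler_norml; apply/andP; split; lra.
  + have := hi; rewrite k0 t0 lee_fin => /(_ N0); rewrite leNgt rx//.
- have kE : k = N :> nat.
    apply/eqP; rewrite eqn_leq kN leqNgt; apply/negP => /hi.
    by rewrite leye_eq.
  by rewrite kE tN (projection_pinfty pp) subrr normr0.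
- have k0 : (k = 0 :> nat)%N.
    by apply/eqP; rewrite -leqn0 leqNgt; apply/negP => /lo; rewrite ltNge leNye.
  by rewrite k0 t0 (projection_ninfty pp) subrr normr0.
Qed.

(** * Discrepancy of closed boxes *)

(** By right continuity of the distribution function, the infimum defining the
quantile is attained when it is finite. *)
Lemma quantile_le (R : realType) (dT : measure_display) (T : measurableType dT)
    (Q : probability T R) (X : {RV Q >-> R}) (y t : R) :
  (quantile (cdf X) y <= t%:E)%E = (y%:E <= cdf X t)%E.
Proof.
apply/idP/idP => [qt|yt]; last by apply: ereal_inf_lbound; exists t.
rewrite leNgt; apply/negP => ty.
have := @cdf_right_continuous _ _ _ Q X t.
move=> /(_ [set z | (z < y%:E)%E]) /=.
have nb : nbhs (cdf X t) [set z | (z < y%:E)%E].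
  by apply: open_nbhs_nbhs; split => //; exact: open_ereal_lt_ereal.
move=> /(_ nb) [e /= e0 he].
have : (quantile (cdf X) y < (t + e)%:E)%E.
  by apply: (le_lt_trans qt); rewrite lte_fin ltrDl.
move/ereal_inf_lt => [_ [x /= yx <-]]; rewrite lte_fin => xte.
have [xt|tx] := leP x t.
  have := cdf_nondecreasing X xt; rewrite leNgt => /negP; apply.
  exact: lt_le_trans ty yx.
have txe : `|t - x| < e by rewrite ltr0_norm ?subr_lt0//; lra.
have /= := he x txe tx.
by apply/negP; rewrite -leNgt.
Qed.

Lemma ler_dist_prod (R : realType) (I : Type) (s : seq I) (a b : I -> R) :
  (forall i, 0 <= a i <= 1) -> (forall i, 0 <= b i <= 1) ->
  `|\prod_(i <- s) a i - \prod_(i <- s) b i| <= \sum_(i <- s) `|a i - b i|.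
Proof.
move=> a01 b01; elim: s => [|i s ih]; first by rewrite !big_nil subrr normr0.
rewrite !big_cons.
set A := \prod_(j <- s) a j in ih *; set B := \prod_(j <- s) b j in ih *.
have A01 : 0 <= A <= 1.
  apply/andP; split; first by apply: prodr_ge0 => j _; case/andP: (a01 j).
  by apply: prodr_ile1 => j _.
have -> : a i * A - b i * B = (a i - b i) * A + b i * (A - B) by ring.
apply: (le_trans (ler_normD _ _)); rewrite !normrM; apply: lerD.
  by rewrite ler_piMr// ger0_norm; case/andP: A01.
apply: le_trans ih; rewrite ler_piMl// ger0_norm; case/andP: (b01 i) => //.
Qed.

(** The star discrepancy only sees half-open boxes inside the unit cube. A
closed box contains the half-open one, and is contained in the box enlarged by
[e] up to the points having a coordinate equal to 1; these escape all
half-open boxes, but the full box shows that their proportion is at most [D],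
whence the factor 2. *)
Lemma closed_box_discrepancy (R : realType) (d n : nat)
    (y : 'I_n -> 'rV[R]_d) (s : 'I_d -> R) (D e : R) :
  (0 < n)%N -> 0 < e -> (forall i j, 0 <= y i 0 j <= 1) ->
  (forall j, 0 <= s j <= 1) -> (star_discrepancy y <= D%:E)%E ->
  `|n%:R^-1 * (\sum_(i < n) \prod_(j < d) (y i 0 j <= s j)%R%:R)
    - \prod_(j < d) s j| <= 2 * D + d%:R * e.
Proof.
move=> n0 e0 y01 s01 yD.
have n0' : 0 < n%:R :> R by rewrite ltr0n.
have box (u : 'rV[R]_d) : (forall j, 0 <= u 0 j <= 1) ->
    `|n%:R^-1 * (\sum_(i < n) \1_(box0 u) (y i)) - \prod_(j < d) u 0 j| <= D.
  move=> u01; rewrite -lee_fin; apply: le_trans yD.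
  by apply: ereal_sup_ubound; exists u.
pose us : 'rV[R]_d := \row_j s j.
pose ue : 'rV[R]_d := \row_j Num.min 1 (s j + e).
pose u1 : 'rV[R]_d := \row_j 1.
have us01 j : 0 <= us 0 j <= 1 by rewrite mxE.
have ue01 j : 0 <= ue 0 j <= 1.
  rewrite mxE le_min ler01 ge_min lexx/= andbT.
  by have /andP[s0 _] := s01 j; rewrite addr_ge0// ltW.
have u101 j : 0 <= u1 0 j <= 1 by rewrite mxE ler01 lexx.
have := box _ us01; have := box _ ue01; have := box _ u101.
have -> : \prod_(j < d) u1 0 j = 1 by apply: big1 => j _; rewrite mxE.
have -> : \prod_(j < d) us 0 j = \prod_(j < d) s j.
  by apply: eq_bigr => j _; rewrite mxE.
have : `|\prod_(j < d) ue 0 j - \prod_(j < d) s j| <= d%:R * e.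
  apply: le_trans (ler_dist_prod _ ue01 s01) _.
  apply: (@le_trans _ _ (\sum_(j < d) e)); last first.
    by rewrite sumr_const card_ord mulr_natl.
  apply: ler_sum => j _; rewrite mxE; have /andP[s0 s1] := s01 j.
  rewrite ler_norml; apply/andP; split.
    by rewrite lerBrDr le_min; apply/andP; split; lra.
  by rewrite lerBlDr ge_min [e + _]addrC lexx orbT.
set Ie := \sum_(i < n) \1_(box0 ue) (y i).
set Is := \sum_(i < n) \1_(box0 us) (y i).
set I1 := \sum_(i < n) \1_(box0 u1) (y i).
set A := \sum_(i < n) _.
have AIs : Is <= A.
  apply: ler_sum => i _; rewrite indicE.
  have [/set_mem yi|_] := boolP (_ \in _); last by rewrite prodr_ge0.
  rewrite big1// => j _; have /andP[_] := yi j.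
  by rewrite mxE => /ltW ->.
have AIe : A <= Ie + (n%:R - I1).
  rewrite -[n%:R]mul1r -{1}(card_ord n) mulr_natr -sumr_const -sumrB.
  rewrite -big_split/=.
  apply: ler_sum => i _; rewrite !indicE.
  have [/set_mem y1|_] := boolP (y i \in box0 u1); last first.
    rewrite subr0 ler_wpDl//; apply: prodr_ile1 => j _.
    by case: (_ <= s j); rewrite /= ?lexx ?ler01.
  rewrite subrr addr0.
  have [_|ye] := boolP (y i \in box0 ue).
    apply: prodr_ile1 => j _.
    by case: (_ <= s j); rewrite /= ?lexx ?ler01.
  have /existsNP[j /negP yj] : ~ forall j, y i 0 j <= s j.
    move=> h; move/negP: ye; apply; rewrite inE => j.
    have /andP[-> /=] := y1 j; rewrite !mxE => yj1.
    rewrite lt_min yj1/= (le_lt_trans (h j))// ltrDl//.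
  by rewrite (bigD1 j)//= (negPf yj) mul0r.
have h1 : n%:R^-1 * Is <= n%:R^-1 * A by rewrite ler_wpM2l// invr_ge0 ltW.
have h2 : n%:R^-1 * A <= n%:R^-1 * Ie + (1 - n%:R^-1 * I1).
  rewrite -[X in _ + (X - _)](@mulVf _ (n%:R)) ?gt_eqF// -mulrBr -mulrDr.
  by rewrite ler_wpM2l// invr_ge0 ltW.
rewrite !ler_norml => /andP[a1 a2] /andP[b1 b2] /andP[c1 c2] /andP[d1 d2].
apply/andP; split; lra.
Qed.

(** * Change of measure *)

Import HBNNSimple.

(** From sets the identity passes to simple functions by linearity, and to all
nonnegative measurable functions by monotone convergence. Both independence and
the normal density are used through this lemma. *)
Lemma ge0_integral_density d1 d2 (T1 : measurableType d1)
    (T2 : measurableType d2) (R : realType)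
    (m1 : {measure set T1 -> \bar R}) (nu : {measure set T2 -> \bar R})
    (X : T1 -> T2) (Z : T1 -> R) (u : T2 -> R) :
  measurable_fun setT X -> measurable_fun setT Z -> (forall x, 0 <= Z x) ->
  measurable_fun setT u -> (forall x, 0 <= u x) ->
  (forall A, measurable A ->
     (\int[m1]_x (\1_A (X x) * Z x)%:E = nu A)%E) ->
  (\int[m1]_x (u (X x) * Z x)%:E = \int[nu]_y (u y)%:E)%E.
Proof.
move=> mX mZ Z0 mu u0 XZ.
have mue : measurable_fun [set: T2] (EFin \o u : T2 -> \bar R).
  exact/measurable_EFinP.
pose h := nnsfun_approx measurableT mue.
have cvgh x : (EFin \o h^~ x) n @[n --> \oo] --> (u x)%:E.
  apply: (@cvg_nnsfun_approx _ _ _ _ measurableT _ mue) => // y _.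
  by rewrite /= lee_fin.
have ndh x : {homo (fun n => h n x) : n m / (n <= m)%N >-> n <= m}.
  by move=> n m nm; exact/lefP/nd_nnsfun_approx.
have -> : (\int[nu]_y (u y)%:E = limn (fun n => \int[nu]_y (h n y)%:E))%E.
  have fE x : (u x)%:E = limn (EFin \o h^~ x) by apply/esym/cvg_lim.
  under eq_integral => x _ do rewrite fE.
  apply: monotone_convergence => //.
  - by move=> n; apply/measurable_EFinP.
  - by move=> n x _ //=; rewrite lee_fin.
  - by move=> x _ a b ab; rewrite lee_fin; exact: ndh.
have mhX n : measurable_fun setT (fun x => h n (X x)).
  exact: (measurableT_comp (@measurable_funPT _ _ _ _ (h n)) mX).
have -> : (\int[m1]_x (u (X x) * Z x)%:E
    = limn (fun n => \int[m1]_x (h n (X x) * Z x)%:E))%E.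
  have fE x : (u (X x) * Z x)%:E = limn (fun n => (h n (X x) * Z x)%:E).
    apply/esym/cvg_lim => //; under eq_fun do rewrite EFinM.
    by rewrite EFinM; apply: cvgeZr => //; exact: cvgh.
  under eq_integral => x _ do rewrite fE.
  apply: monotone_convergence => //.
  - move=> n; apply/measurable_EFinP; exact: measurable_funM.
  - by move=> n x _ //=; rewrite lee_fin mulr_ge0.
  - by move=> x _ a b ab; rewrite lee_fin ler_wpM2r//; exact: ndh.
suff suf n : (\int[m1]_x (h n (X x) * Z x)%:E = \int[nu]_y (h n y)%:E)%E.
  by under eq_fun do rewrite suf.
have mpre y : measurable (h n @^-1` [set y]) by exact: measurable_sfunP.
have mind y : measurable_fun setT (fun x => \1_(h n @^-1` [set y]) (X x) : R).
  have mi := @measurable_indic _ T2 R setT _ (mpre y).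
  exact: (measurableT_comp mi mX).
have mindZ y : measurable_fun setT
    (fun x => (\1_(h n @^-1` [set y]) (X x) * Z x)%:E).
  by apply/measurable_EFinP; apply: measurable_funM.
rewrite integralT_nnsfun sintegralE.
transitivity (\int[m1]_x \sum_(y \in range (h n))
    (y%:E * (\1_(h n @^-1` [set y]) (X x) * Z x)%:E))%E.
  apply: eq_integral => x _; rewrite fimfunE.
  rewrite fsbig_finite//= fsbig_finite//= mulr_suml -sumEFin.
  by apply: eq_bigr => y _; rewrite -mulrA EFinM.
rewrite ge0_integral_fsum//.
- apply: eq_fsbigr => y; rewrite inE => -[t _ <-].
  rewrite ge0_integralZl_EFin// ?XZ//.
  by move=> x _; rewrite lee_fin mulr_ge0.
- by move=> y; apply: emeasurable_funM.
- move=> y x _; have [y0|y0] := leP 0 y.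
    by apply: mule_ge0; rewrite lee_fin// mulr_ge0.
  rewrite indicE; have [|_] := boolP (_ \in _); last by rewrite mul0r mule0.
  by rewrite inE => /= hy; move: y0; rewrite -hy ltNge fun_ge0.
Qed.

(** Independence is only given for events. Indicators are replaced by general
functions one coordinate at a time: with the other factors fixed, the
expectation is a measure in the event of the remaining coordinate. *)
Lemma mutually_independent_prod (R : realType) (dO : measure_display)
    (O : measurableType dO) (P : probability O R) (d : nat)
    (X : 'I_d -> {RV P >-> R}) (w : 'I_d -> R -> R) (e : 'I_d -> R) :
  mutually_independent X ->
  (forall j, measurable_fun setT (w j)) -> (forall j x, 0 <= w j x) ->
  (forall j, (\int[P]_x (w j (X j x))%:E = (e j)%:E)%E) ->
  (\int[P]_x (\prod_(j < d) w j (X j x))%:E = (\prod_(j < d) e j)%:E)%E.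
Proof.
(* [s] lists the coordinates whose factor need not be an indicator *)
move=> indX; suff H (s : seq 'I_d) : forall w e,
    (forall j, j \notin s ->
       exists2 A, measurable A & w j = \1_A :> (R -> R)) ->
    (forall j, measurable_fun setT (w j)) -> (forall j x, 0 <= w j x) ->
    (forall j, (\int[P]_x (w j (X j x))%:E = (e j)%:E)%E) ->
    (\int[P]_x (\prod_(j < d) w j (X j x))%:E = (\prod_(j < d) e j)%:E)%E.
  by move=> mw w0 we; apply: (H (enum 'I_d)) => // j; rewrite mem_enum.
elim: s => {w e} [w e wA _ _ we|j s ih w e wA mw w0 we].
  have {wA} wA j : {A | measurable A & w j = \1_A :> (R -> R)}.
    by apply: cid2; apply: wA; rewrite in_nil.
  pose A j := s2val (wA j).
  have mA j : measurable (A j) by rewrite /A; case: (wA j).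
  have wE j : w j = \1_(A j) :> (R -> R) by rewrite /A; case: (wA j).
  have eE j : (e j)%:E = P (X j @^-1` A j).
    rewrite -we; under eq_integral do rewrite wE.
    have -> : (fun x => (\1_(A j) (X j x))%:E) =
              (fun x => (\1_(X j @^-1` A j) x)%:E :> \bar R).
      by apply/funext => x; rewrite !indicE.
    by rewrite integral_indic ?setIT//; exact: measurable_funPTI.
  rewrite -prodEFin; under [RHS]eq_bigr do rewrite eE.
  rewrite -indX//.
  have -> : (fun x => (\prod_(j < d) w j (X j x))%:E) = (fun x =>
     (\1_(\bigcap_(j in [set: 'I_d]) (X j @^-1` A j)) x)%:E :> \bar R).
    apply/funext => x; congr (_%:E); rewrite indicE.
    have [/set_mem xA|xA] := boolP (_ \in _).
      rewrite big1// => i _; rewrite wE indicE mem_set//.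
      exact: (xA i).
    have /existsNP[i /negP] : ~ forall i, X i x \in A i.
      move=> h; move/negP: xA; apply; rewrite inE => i _.
      by have := h i; rewrite inE.
    by rewrite (bigD1 i)//= wE indicE => /negPf ->; rewrite mul0r.
  rewrite integral_indic ?setIT//.
  by apply: fin_bigcap_measurable => // i _; exact: measurable_funPTI.
have ej0 i : 0 <= e i.
  rewrite -lee_fin -we; apply: integral_ge0 => x _.
  by rewrite lee_fin.
have c0 : 0 <= \prod_(i < d | i != j) e i by apply: prodr_ge0.
pose nu := mscale (NngNum c0) (distribution P (X j)).
under eq_integral do rewrite (bigD1 j)//=.
rewrite (@ge0_integral_density _ _ _ _ _ _ nu (X j)
  (fun x => \prod_(i < d | i != j) w i (X i x)) (w j))//.
- have mwe : measurable_fun setT (fun x => (w j x)%:E).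
    exact/measurable_EFinP.
  rewrite (ge0_integral_mscale _ measurableT)//=; last first.
    by move=> x _; rewrite lee_fin.
  rewrite ge0_integral_distribution//.
    by rewrite /comp/= we [in RHS](bigD1 j)//= -EFinM mulrC.
  by move=> y; rewrite lee_fin.
- under eq_fun do rewrite -big_filter.
  by apply: measurable_prod => i _; exact: (measurableT_comp (mw i)).
- by move=> x; apply: prodr_ge0.
- move=> A mA.
  have PA : P (X j @^-1` A) = (fine (P (X j @^-1` A)))%:E.
    by rewrite fineK// fin_num_measure//; exact: measurable_funPTI.
  pose w' i := if i == j then \1_A else w i.
  pose e' i := if i == j then fine (P (X j @^-1` A)) else e i.
  have e'E : \prod_(i < d) e' i =
      fine (P (X j @^-1` A)) * \prod_(i < d | i != j) e i.
    rewrite (bigD1 j)//= /e' eqxx; congr (_ * _).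
    by apply: eq_bigr => i /negPf ->.
  have w'E x : \prod_(i < d) w' i (X i x) =
      \1_A (X j x) * \prod_(i < d | i != j) w i (X i x).
    rewrite (bigD1 j)//= /w' eqxx; congr (_ * _).
    by apply: eq_bigr => i /negPf ->.
  under eq_integral do rewrite -w'E.
  rewrite (ih w' e') ?e'E; first by rewrite EFinM -PA muleC.
  + move=> i; rewrite /w'; case: eqP => [_ _|/eqP ij si]; first by exists A.
    by apply: wA; rewrite inE negb_or ij.
  + by move=> i; rewrite /w'; case: eqP => // _; exact: measurable_indic.
  + by move=> i x; rewrite /w'; case: eqP => // _.
  + move=> i; rewrite /w' /e'; case: eqP => // ->.
    rewrite -PA.
    have -> : (fun x => (\1_A (X j x))%:E) =
              (fun x => (\1_(X j @^-1` A) x)%:E :> \bar R).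
      by apply/funext => x; rewrite !indicE.
    by rewrite integral_indic ?setIT//; exact: measurable_funPTI.
Qed.

(** An open set is a countable union of cubes with rational centres and radii
[1 / m.+1]. *)
Lemma measurable_preimage_rvec (R : realType) (dO : measure_display)
    (O : measurableType dO) (P : probability O R) (d : nat)
    (W : 'I_d -> {RV P >-> R}) (V : set 'rV[R]_d) :
  open V -> measurable [set w | V (rvec W w)].
Proof.
move=> oV.
pose B (c : 'rV[rat]_d * nat) : set 'rV[R]_d :=
  [set x | forall j, `|x 0 j - ratr (c.1 0 j)| < c.2.+1%:R^-1].
pose F (c : 'rV[rat]_d * nat) : set O :=
  if pselect (B c `<=` V) then [set w | B c (rvec W w)] else set0.
have -> : [set w | V (rvec W w)] = \bigcup_c F c.
  apply/seteqP; split=> [w /= Vw|w [c _]]; last first.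
    by rewrite /F; case: pselect => // BV /BV.
  have /nbhs_ballP[e /= e0 he] : nbhs (rvec W w) V by exact: open_nbhs_nbhs.
  have [m me] : exists m, m.+1%:R^-1 < e / 2.
    have e20 : 0 < e / 2 by lra.
    have [N _ /(_ N)] := near_infty_natSinv_lt (PosNum e20).
    by move=> /(_ (leqnn _)) h; exists N.
  have m0 : 0 < m.+1%:R^-1 :> R by rewrite invr_gt0 ltr0n.
  have /cid/= q : exists q : 'rV[rat]_d, B (q, m) (rvec W w).
    have H j : exists q, `|rvec W w 0 j - ratr q| < m.+1%:R^-1 :> R.
      have [|q] := @rat_in_itvoo R (rvec W w 0 j - m.+1%:R^-1)
                                   (rvec W w 0 j + m.+1%:R^-1).
        by rewrite ltrD2l (lt_trans _ m0)// oppr_lt0.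
      rewrite in_itv/= => /andP[q1 q2]; exists q.
      by rewrite ltr_distlC q1 q2.
    exists (\row_j sval (cid (H j))) => j /=.
    by rewrite mxE; case: cid.
  case: q => q Bq; exists (q, m) => //; rewrite /F.
  case: pselect => // -[] z Bz.
  apply: he; split=> // i j; rewrite (ord1 i) /ball/=.
  have -> : rvec W w 0 j - z 0 j =
    (rvec W w 0 j - ratr (q 0 j)) - (z 0 j - ratr (q 0 j)) by ring.
  apply: (le_lt_trans (ler_normB _ _)).
  rewrite (splitr e); have /= h1 := Bq j; have /= h2 := Bz j.
  by apply: ltrD; [exact: lt_trans h1 me|exact: lt_trans h2 me].
apply: countable_bigcupT_measurable; [exact: countableP|].
move=> c; rewrite /F; case: pselect => //= BV.
have -> : [set w | B c (rvec W w)] = \bigcap_(j in [set: 'I_d])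
    (W j @^-1` ball (ratr (c.1 0 j) : R) (c.2.+1%:R^-1)).
  apply/seteqP; split=> [w /= Bw j _|w h j].
    by rewrite /= /ball/= distrC; have := Bw j; rewrite mxE.
  by rewrite mxE distrC; exact: (h j Logic.I).
apply: fin_bigcap_measurable => // j _.
rewrite -[X in measurable X]setTI; apply: (measurable_funP (W j)) => //.
exact: measurable_ball.
Qed.

Lemma measurable_continuous_rvec (R : realType) (dO : measure_display)
    (O : measurableType dO) (P : probability O R) (d : nat)
    (W : 'I_d -> {RV P >-> R}) (f : 'rV[R]_d -> R) :
  continuous f -> measurable_fun setT (fun w => f (rvec W w)).
Proof.
move=> /continuousP cf; apply: (measurability _ (RGenOpens.measurableE R)).
move=> _ [_ [a [b ->] <-]]; rewrite setTI.
apply: (@measurable_preimage_rvec _ _ _ _ _ W (f @^-1` `]a, b[%classic)).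
exact/cf/interval_open.
Qed.

Lemma measurable_density_ratio (R : realType) (g : R -> R) :
  measurable_fun setT g -> measurable_fun setT (fun x => g x / phi x).
Proof.
move=> mg; apply: measurable_funM => //; apply: continuous_measurable_fun => x.
apply: cvgV; first by rewrite gt_eqF// std_normal_pdf_gt0.
by apply: continuous_normal_pdf; rewrite oner_eq0.
Qed.

(** Against the normal law the ratio [g j / phi] integrates over [A j] to the
integral of [g j], and independence multiplies these one-variable integrals. *)
Lemma expectation_density_ratio (R : realType) (dO : measure_display)
    (O : measurableType dO) (P : probability O R) (d : nat)
    (W : 'I_d -> {RV P >-> R}) (g : 'I_d -> R -> R) (A : 'I_d -> set R)
    (e : 'I_d -> R) :
  std_normal_vector W ->
  (forall j, measurable_fun setT (g j)) -> (forall j x, 0 <= g j x) ->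
  (forall j, measurable (A j)) ->
  (forall j, (\int[lebesgue_measure]_(x in A j) (g j x)%:E = (e j)%:E)%E) ->
  (\int[P]_w (\prod_(j < d)
     (\1_(A j) (W j w) * (g j (W j w) / normal_pdf 0 1 (W j w))))%:E
   = (\prod_(j < d) e j)%:E)%E.
Proof.
move=> [indW dW] mg g0 mA gA.
have phi0 x : 0 < phi x :> R by exact: std_normal_pdf_gt0.
have mphi : measurable_fun setT (phi : R -> R).
  exact: measurable_normal_pdf.
pose w j x := \1_(A j) x * (g j x / normal_pdf 0 1 x).
have mw j : measurable_fun setT (w j).
  apply: measurable_funM; first exact: measurable_indic.
  exact: measurable_density_ratio.
have w0 j x : 0 <= w j x by rewrite mulr_ge0// divr_ge0// ltW.
apply: (mutually_independent_prod (w := w)) => // j.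
transitivity (\int[normal_prob 0 1]_x (w j x)%:E)%E.
  under eq_integral do rewrite -[w _ _]mulr1.
  have dWj B : measurable B ->
      (\int[P]_x (\1_B (W j x) * cst 1 x)%:E = normal_prob 0 1 B)%E.
    move=> mB; rewrite -(dW j)//; under eq_integral do rewrite mulr1.
    have -> : (fun x => (\1_B (W j x))%:E) =
              (fun x => (\1_(W j @^-1` B) x)%:E :> \bar R).
      by apply/funext => x; rewrite !indicE.
    by rewrite integral_indic ?setIT//; exact: measurable_funPTI.
  apply: (@ge0_integral_density _ _ _ _ _ _ (normal_prob 0 1) (W j)
    (cst 1)) => //.
    exact: (measurable_funP (W j)).
  exact: mw.
have dphi B : measurable B ->
    (\int[lebesgue_measure]_x (\1_B x * normal_pdf 0 1 x)%:E
     = normal_prob 0 1 B)%E.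
  move=> mB; rewrite /normal_prob [RHS]integral_mkcond.
  apply: eq_integral => x _; rewrite patchE indicE.
  by case: (x \in B); rewrite ?mul1r ?mul0r.
transitivity (\int[lebesgue_measure]_x (w j x * normal_pdf 0 1 x)%:E)%E.
  apply/esym; apply: (@ge0_integral_density _ _ _ _ _ lebesgue_measure
    (normal_prob 0 1) id (normal_pdf 0 1)) => //.
  - by move=> x; exact: ltW (phi0 x).
  - exact: mw.
  - exact: dphi.
rewrite -gA [RHS]integral_mkcond; apply: eq_integral => x _.
rewrite patchE /w indicE /=; case: (x \in A j); rewrite ?mul1r ?mul0r//.
by rewrite divfK// gt_eqF.
Qed.

(** Integrating a pointwise error of at most [eta * rho] costs [eta], because
[rho] has mass 1; [Y] itself may be unbounded. *)
Lemma expectation_approx (R : realType) (dO : measure_display)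
    (O : measurableType dO) (P : {measure set O -> \bar R}) (I : Type)
    (L : seq I) (c e : I -> R) (u : I -> O -> R) (Y rho : O -> R) (eta : R) :
  (forall i, measurable_fun setT (u i)) -> (forall i x, 0 <= u i x) ->
  (forall i, (\int[P]_x (u i x)%:E = (e i)%:E)%E) ->
  measurable_fun setT rho -> (forall x, 0 <= rho x) ->
  (\int[P]_x (rho x)%:E = 1)%E -> measurable_fun setT Y ->
  (forall x, `|Y x - \sum_(i <- L) c i * u i x| <= eta * rho x) ->
  exists2 EY, (\int[P]_x (Y x)%:E = EY%:E)%E &
    `|EY - \sum_(i <- L) c i * e i| <= eta.
Proof.
move=> mu u0 ue mrho rho0 rho1 mY YZ.
have nnint (v : O -> R) (a : R) : measurable_fun setT v ->
    (forall x, 0 <= v x) -> (\int[P]_x (v x)%:E = a%:E)%E ->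
    P.-integrable setT (fun x => (v x)%:E).
  move=> mv v0 va; apply/integrableP; split; first exact/measurable_EFinP.
  by under eq_integral do rewrite abse_EFin ger0_norm//; rewrite va ltry.
pose Z x := \sum_(i <- L) c i * u i x.
have ZE : (fun x => (Z x)%:E) =
    (fun x => \sum_(i <- L) ((c i)%:E * (u i x)%:E))%E.
  by apply/funext => x; rewrite /Z -sumEFin.
have intu i : P.-integrable setT (fun x => (c i)%:E * (u i x)%:E)%E.
  by apply: integrableZl => //; apply: nnint (ue i).
have intZ : P.-integrable setT (fun x => (Z x)%:E).
  by rewrite ZE; apply: integrable_sum.
have mZ : measurable_fun setT Z.
  by apply/measurable_EFinP; exact: measurable_int intZ.
have mD : measurable_fun setT (fun x => (Y x - Z x)%:E).
  by apply/measurable_EFinP; exact: measurable_funB.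
have intrho : P.-integrable setT (fun x => eta%:E * (rho x)%:E)%E.
  by apply: integrableZl => //; apply: nnint rho1.
have eta0 : 0 <= eta.
  rewrite leNgt; apply/negP => eta0.
  have rho_eq0 x : rho x = 0.
    apply/eqP; rewrite eq_le rho0 andbT leNgt; apply/negP => rx.
    have := le_trans (normr_ge0 _) (YZ x).
    by rewrite nmulr_rge0// leNgt rx.
  move: rho1; under eq_integral do rewrite rho_eq0.
  by rewrite integral0 => -[/eqP]; rewrite eq_sym oner_eq0.
have intD : P.-integrable setT (fun x => (Y x - Z x)%:E).
  apply: le_integrable intrho => // x _.
  rewrite -EFinM !abse_EFin lee_fin; apply: (le_trans (YZ x)).
  by rewrite ler_norm.
have fD : (\int[P]_x (Y x - Z x)%:E)%E \is a fin_num.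
  exact: integrable_fin_num.
have := fineK fD; set dl := fine _ => dlE.
exists (\sum_(i <- L) c i * e i + dl).
  transitivity (\int[P]_x ((Z x)%:E + (Y x - Z x)%:E))%E.
    by apply: eq_integral => x _; rewrite -EFinD addrC subrK.
  rewrite integralD//= EFinD dlE; congr (_ + _)%E.
  rewrite ZE integral_sum// -sumEFin; apply: eq_bigr => i _.
  by rewrite integralZl//; [rewrite ue|exact: nnint (ue i)].
rewrite addrC addKr -lee_fin -abse_EFin dlE.
apply: (le_trans (le_abse_integral P measurableT mD)).
apply: (@le_trans _ _ (\int[P]_x (eta%:E * (rho x)%:E))%E).
  have mabs : measurable_fun setT (fun x => `|(Y x - Z x)%:E|)%E.
    exact: measurableT_comp.
  have merho : measurable_fun setT (fun x => eta%:E * (rho x)%:E)%E.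
    exact: measurable_int intrho.
  apply: ge0_le_integral => //.
  by move=> x _; rewrite -EFinM abse_EFin lee_fin; exact: YZ.
rewrite integralZl// ?rho1 ?mule1//; exact: nnint rho1.
Qed.

Lemma cdf_density (R : realType) (dT : measure_display) (T : measurableType dT)
    (Q : probability T R) (X : {RV Q >-> R}) (g : R -> R) (t : R) :
  has_density X g ->
  (\int[lebesgue_measure]_(x in `]-oo, t]) (g x)%:E = (fine (cdf X t))%:E)%E.
Proof.
by move=> [_ _ gX]; rewrite fineK ?fin_num_measure// -gX.
Qed.

Lemma density_integral1 (R : realType) (dT : measure_display)
    (T : measurableType dT) (Q : probability T R) (X : {RV Q >-> R})
    (g : R -> R) :
  has_density X g -> (\int[lebesgue_measure]_x (g x)%:E = 1)%E.
Proof. by move=> [_ _ gX]; rewrite -gX// probability_setT. Qed.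

(** Either [x] is fixed by the projection, or some coordinate of [x] exceeds
[r - 1] in absolute value; that coordinate of the projected point is then at
least [r - 1] in absolute value as well, and the function is small at both
points. *)
Lemma truncation_error (R : realType) (d : nat) (M B : R) (f : 'rV[R]_d -> R)
    (r : R) (p : \bar R -> R) (x : 'rV[R]_d) :
  M < 1 / 2 -> 0 < B -> Ge2 M B f ->
  1 <= r -> is_projection r p ->
  `|std_normal_density x * f x -
    std_normal_density (\row_j p (x 0 j)%:E) * f (\row_j p (x 0 j)%:E)|
  <= 2 * (B * expR (- (1 / 2 - M) * (r - 1) ^+ 2)).
Proof.
move=> M2 B0 fG r1 pp; have [pid _ _ pgrow _] := pp; set z := \row_j _.
have r10 : 0 <= r - 1 by rewrite subr_ge0.
set bd := B * _; have bd0 : 0 <= bd by rewrite mulr_ge0 ?expR_ge0// ltW.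
have [/forallP xr|] := boolP [forall j, `|x 0 j| <= r - 1].
  suff -> : z = x by rewrite subrr normr0 mulr_ge0.
  apply/rowP => j; rewrite mxE; apply: pid.
  by have := xr j; rewrite ler_norml opprB [1 - r]addrC.
rewrite negb_forall => /existsP[j]; rewrite -ltNge => xj.
apply: (le_trans (ler_normB _ _)); have -> : 2 * bd = bd + bd by ring.
apply: lerD; apply: (@std_normal_density_tail _ _ _ _ _ _ j _ M2 B0 fG) => //.
  exact: ltW.
rewrite mxE; have := (pgrow (x 0 j)).1.
have -> : (`|x 0 j| <= r - 1) = false by rewrite leNgt xj.
by rewrite xj mulr0 add0r mulr1.
Qed.

(** * The error bound *)

(** The three terms are the Koksma-Hlawka bound, the truncation error and the
error of rounding to the grid, which is incurred once for the sample mean and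
once for the expectation. *)
Lemma IS_error_le (R : realType) (d n N : nat) (M B A D r : R)
    (dO : measure_display) (O : measurableType dO) (P : probability O R)
    (W : 'I_d -> {RV P >-> R}) (p : \bar R -> R) (y : 'I_n -> 'rV[R]_d)
    (er : \bar R) :
  M < 1 / 2 -> 0 < B -> std_normal_vector W -> (0 < n)%N -> (0 < N)%N ->
  1 <= r -> is_projection r p -> (forall i j, 0 <= y i 0 j <= 1) ->
  (star_discrepancy y <= D%:E)%E -> IS_errors M B A W p y er ->
  (er <= (mixed_bound d M B * (1 + 2 * r) ^+ d * (2 * D + d%:R / n%:R)
          + 2 * (B * expR (- (1 / 2 - M) * (r - 1) ^+ 2))
          + 2 * (mixed_bound d M B * (d%:R * (2 * r / N%:R))))%:E)%E.
Proof.
move=> M2 B0 WN n0 N0 r1 pp y01 yD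
  [dT [T [Q [tau [g [h [_ gtau _ [hg0 fG] ->]]]]]]].
have r0 : 0 <= r by lra.
have Nr0 : 0 < N%:R :> R by rewrite ltr0n.
have nr0 : 0 < n%:R :> R by rewrite ltr0n.
set K0 := mixed_bound d M B; set mesh := 2 * r / N%:R.
set tail := 2 * (B * _).
have K00 : 0 <= K0 by exact: mixed_bound_ge0.
have mesh0 : 0 <= mesh by rewrite divr_ge0// mulr_ge0.
pose f x := h x / prod_density g x.
pose H x := std_normal_density x * f x.
have nH : mpartials_le (enum 'I_d) H (cst K0).
  exact: std_normal_density_mpartials_le.
pose t := grid r N; pose v k := p (t k)%:E.
have tmono := grid_le N r0.
pose L := abel N v (enum 'I_d) H.
have bigE (F : 'I_d -> R) : \prod_(j <- enum 'I_d) F j = \prod_(j < d) F j.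
  by rewrite big_enum.
have expand (x : 'I_d -> \bar R) : H (\row_j v (cell N t (x j))) =
    \sum_(c <- L) c.1 * \prod_(j < d) (x j <= node t (c.2 j))%E%:R.
  have := abel_expand v H (fun j => cell N t (x j)) (enum_uniq 'I_d).
  under eq_bigr do rewrite bigE; under eq_bigr do
    under eq_bigr do rewrite (cell_le _ _ tmono).
  move=> ->; congr H; apply/rowP => j.
  by rewrite !mxE mem_enum.
have near_cell (x : 'I_d -> \bar R) :
    `|H (\row_j p (x j)) - H (\row_j v (cell N t (x j)))|
    <= K0 * (d%:R * mesh).
  apply: (le_trans (mpartials_le_lipschitz _ _ nH)); rewrite ler_wpM2l//.
  apply: (@le_trans _ _ (\sum_(j < d) mesh)); last first.
    by rewrite sumr_const card_ord [leRHS]mulr_natl.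
  by apply: ler_sum => j _; rewrite !mxE; exact: projection_cell.
have L1 : \sum_(c <- L) `|c.1| <= K0 * (1 + 2 * r) ^+ d.
  have := @abel_bound _ d N v (enum 'I_d) H K0 mesh.
  have -> : N%:R * mesh = 2 * r by rewrite /mesh mulrC divfK// gt_eqF.
  rewrite size_enum_ord; apply => //.
  - move=> k _; apply: (le_trans (projection_lipschitz _ _ pp)).
    by rewrite /t gridS opprD addrA subrr sub0r normrN ger0_norm.
  - exact: enum_uniq.
pose Fn j (k : 'I_N.+1) := if (k < N)%N then fine (cdf (tau j) (t k)) else 1.
have Fn01 j k : 0 <= Fn j k <= 1.
  rewrite /Fn; case: ifP => _; last by rewrite ler01 lexx.
  rewrite fine_ge0 ?cdf_ge0//= -lee_fin fineK ?cdf_le1//.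
  by rewrite fin_num_measure.
have quant j (a : R) k : a <= 1 ->
    (quantile (cdf (tau j)) a <= node t k)%E = (a <= Fn j k).
  move=> a1; rewrite /node /Fn; case: ifP => _; last by rewrite leey a1.
  by rewrite quantile_le -lee_fin fineK// fin_num_measure.
pose X i j := quantile (cdf (tau j)) (y i 0 j).
set S := proj_estimator _ _ _ _.
pose S' := n%:R^-1 * \sum_(i < n) H (\row_j v (cell N t (X i j))).
have SS' : `|S - S'| <= K0 * (d%:R * mesh).
  rewrite /S /S' /proj_estimator -mulrBr -sumrB normrM ger0_norm ?invr_ge0//.
  rewrite ler_pdivrMl//.
  apply: (le_trans (ler_norm_sum _ _ _)).
  apply: (@le_trans _ _ (\sum_(i < n) K0 * (d%:R * mesh))); last first.
    by rewrite sumr_const card_ord [leRHS]mulr_natl.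
  have hE x : h_IS g h x = H x by rewrite /h_IS /H /f mulrA.
  by apply: ler_sum => i _; rewrite hE; exact: (near_cell (X i)).
have S'E : S' = \sum_(c <- L) c.1 * (n%:R^-1 *
    \sum_(i < n) \prod_(j < d) (y i 0 j <= Fn j (c.2 j))%R%:R).
  rewrite /S'; under eq_bigr do rewrite expand.
  rewrite exchange_big/= mulr_sumr; apply: eq_bigr => c _.
  rewrite -mulr_sumr mulrCA; congr (_ * (_ * _)).
  apply: eq_bigr => i _; apply: eq_bigr => j _.
  by rewrite quant//; case/andP: (y01 i j).
pose delta := 2 * D + d%:R / n%:R.
have box c : `|n%:R^-1 *
    (\sum_(i < n) \prod_(j < d) (y i 0 j <= Fn j (c j))%R%:R) -
    \prod_(j < d) Fn j (c j)| <= delta.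
  by apply: closed_box_discrepancy => //; rewrite invr_gt0.
have delta0 : 0 <= delta by exact: le_trans (normr_ge0 _) (box (fun=> ord0)).
pose F := \sum_(c <- L) c.1 * \prod_(j < d) Fn j (c.2 j).
have S'F : `|S' - F| <= K0 * (1 + 2 * r) ^+ d * delta.
  rewrite S'E /F -sumrB; apply: (le_trans (ler_norm_sum _ _ _)).
  apply: (@le_trans _ _ (\sum_(c <- L) `|c.1| * delta)).
    by apply: ler_sum => c _; rewrite -mulrBr normrM ler_wpM2l.
  by rewrite -mulr_suml ler_wpM2r.
(* [rho] is the likelihood ratio of [tau] with respect to [W] *)
pose rho w := \prod_(j < d) (g j (W j w) / normal_pdf 0 1 (W j w)).
pose S0 (k : 'I_N.+1) : set R :=
  if (k < N)%N then `]-oo, t k]%classic else setT.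
pose u (c : R * ('I_d -> 'I_N.+1)) w := \prod_(j < d)
  (\1_(S0 (c.2 j)) (W j w) * (g j (W j w) / normal_pdf 0 1 (W j w))).
have mg j : measurable_fun setT (g j) by case: (gtau j).
have g0 j x : 0 <= g j x by case: (gtau j).
have phi0 x : 0 < normal_pdf (0 : R) 1 x by exact: std_normal_pdf_gt0.
have mS0 k : measurable (S0 k) by rewrite /S0; case: ifP.
have mW j : measurable_fun setT (W j) by exact: (measurable_funP (W j)).
have mratio j :
    measurable_fun setT (fun w => g j (W j w) / normal_pdf 0 1 (W j w)).
  exact: (measurableT_comp (measurable_density_ratio (mg j)) (mW j)).
have ratio0 j w : 0 <= g j (W j w) / normal_pdf 0 1 (W j w).
  by rewrite divr_ge0// ltW.
have uE c : (\int[P]_w (u c w)%:E = (\prod_(j < d) Fn j (c.2 j))%:E)%E.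
  apply: expectation_density_ratio => // j; rewrite /S0 /Fn.
  case: ifP => _; first by apply: cdf_density.
  by have := density_integral1 (gtau j).
have rhoE : (\int[P]_w (rho w)%:E = 1)%E.
  have := @expectation_density_ratio _ _ _ _ _ W g (fun=> setT) (fun=> 1)
    WN mg g0 (fun=> measurableT) (fun j => density_integral1 (gtau j)).
  rewrite big1// => <-; apply: eq_integral => w _; congr EFin.
  by apply: eq_bigr => j _; rewrite indicT mul1r.
have rho0 w : 0 <= rho w by apply: prodr_ge0.
have uW c w : u c w =
    (\prod_(j < d) ((W j w)%:E <= node t (c.2 j))%E%:R) * rho w.
  rewrite /u big_split/=; congr (_ * _); apply: eq_bigr => j _.
  rewrite indicE /S0 /node; case: ifP => _; last by rewrite in_setT leey.
  by congr (nat_of_bool _)%:R; apply/idP/idP; rewrite inE/= in_itv/= lee_fin.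
pose Y w := h (rvec W w).
have YE w : Y w = H (rvec W w) * rho w.
  have : 0 < std_normal_density (rvec W w) by apply: prodr_gt0 => j _.
  have -> : rho w = prod_density g (rvec W w) / std_normal_density (rvec W w).
    rewrite /rho big_split/= prodfV; congr (_ * _).
      by apply: eq_bigr => j _; rewrite mxE.
    by congr GRing.inv; apply: eq_bigr => j _; rewrite mxE.
  rewrite /Y /H /f => sn0.
  have [gz|gnz] := eqVneq (prod_density g (rvec W w)) 0.
    by rewrite hg0// mul0r mulr0 mul0r.
  by field; rewrite gnz gt_eqF.
have cf : continuous f.
  by have := (fG.1 (finset.set0 : {set _})).2; rewrite /dmixed enum_set0.
have mY : measurable_fun setT Y.
  have -> : Y = (fun w => f (rvec W w) * \prod_(j < d) g j (W j w)).
    apply/funext => w; rewrite /Y /f.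
    have -> : \prod_(j < d) g j (W j w) = prod_density g (rvec W w).
      by apply: eq_bigr => j _; rewrite mxE.
    have [gz|gnz] := eqVneq (prod_density g (rvec W w)) 0.
      by rewrite gz mulr0 hg0.
    by rewrite divfK.
  apply: measurable_funM; first exact: measurable_continuous_rvec.
  by apply: measurable_prod => j _; exact: (measurableT_comp (mg j) (mW j)).
have approx w : `|Y w - \sum_(c <- L) c.1 * u c w|
    <= (tail + K0 * (d%:R * mesh)) * rho w.
  have -> : \sum_(c <- L) c.1 * u c w =
      H (\row_j v (cell N t (W j w)%:E)) * rho w.
    rewrite (expand (fun j => (W j w)%:E)) mulr_suml.
    by apply: eq_bigr => c _; rewrite uW mulrA.
  rewrite YE -mulrBl normrM (ger0_norm (rho0 w)) ler_wpM2r//.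
  apply: (le_trans (ler_distD (H (\row_j p (W j w)%:E)) _ _)).
  apply: lerD; last exact: (near_cell (fun j => (W j w)%:E)).
  have := truncation_error (rvec W w) M2 B0 fG r1 pp.
  have -> : \row_j p (rvec W w 0 j)%:E = \row_j p (W j w)%:E.
    by apply/rowP => j; rewrite !mxE.
  exact.
have [|||EY EYE EYF] := @expectation_approx _ _ _ P _ L (fun c => c.1)
  (fun c => \prod_(j < d) Fn j (c.2 j)) u Y rho _ _ _ uE _ rho0 rhoE mY approx.
- move=> c; apply: measurable_prod => j _; apply: measurable_funM => //.
  have mi := @measurable_indic _ _ R setT _ (mS0 (c.2 j)).
  exact: (measurableT_comp mi (mW j)).
- by move=> c w; rewrite uW mulr_ge0// prodr_ge0.
- by apply: measurable_prod => j _.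
rewrite unlock EYE -EFinB abse_EFin lee_fin.
have -> : S - EY = (S - S') + (S' - F) + (F - EY) by ring.
have EYF' : `|F - EY| <= tail + K0 * (d%:R * mesh) by rewrite distrC.
have := ler_normD (S - S' + (S' - F)) (F - EY).
have := ler_normD (S - S') (S' - F).
rewrite -/delta; lra.
Qed.

Lemma powR_three_half (R : realType) (d : nat) (l : R) : (0 < d)%N -> 0 < l ->
  l `^ (3 * d%:R / 2 - 1) = Num.sqrt l ^+ d * l ^+ d.-1.
Proof.
case: d => // d _ l0; have l0' := ltW l0.
have -> : 3 * d.+1%:R / 2 - 1 = 2^-1 * d.+1%:R + d%:R :> R.
  by rewrite -natr1; field.
rewrite powRD; last by rewrite (gt_eqF l0) implybT.
by rewrite powRrM powR12_sqrt// !powR_mulrn// sqrtr_ge0.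
Qed.

Theorem theorem5p6 (R : realType) (d : nat) (d_gt0 : (0 < d)%N)
    (M B A C : R) (M_gt0 : 0 < M) (M_lt : M < 1 / 2) (B_gt0 : 0 < B)
    (dO : measure_display) (O : measurableType dO) (P : probability O R)
    (W : 'I_d -> {RV P >-> R}) (W_normal : std_normal_vector W) :
  exists K : R, \forall n \near \oo,
    forall (y : 'I_n -> 'rV[R]_d) (p : \bar R -> R),
      (forall i j, 0 <= y i 0 j <= 1) ->
      (star_discrepancy y <= (C * ln n%:R ^+ d.-1 / n%:R)%:E)%E ->
      is_projection (Num.sqrt (2 / (1 - 2 * M) * ln n%:R) + 1) p ->
      (ereal_sup (IS_errors M B A W p y)
        <= (K * (n%:R^-1 * ln n%:R `^ (3 * d%:R / 2 - 1)))%:E)%E.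
Proof.
pose K0 := mixed_bound d M B.
have K00 : 0 <= K0 by exact: mixed_bound_ge0.
have M12 : 0 < 1 - 2 * M by lra.
pose al := Num.sqrt (2 / (1 - 2 * M)).
have al0 : 0 <= al by exact: sqrtr_ge0.
exists (K0 * (3 + 2 * al) ^+ d * (2 * `|C| + d%:R) + 2 * B + 2 * K0 * d%:R).
near=> n => y p y01 yD pp.
have ne : expR 1 <= n%:R :> R by near: n; exact: nbhs_infty_ger.
have nr0 : 0 < n%:R :> R by exact: lt_le_trans (expR_gt0 1) ne.
have n0 : (0 < n)%N by rewrite -(ltr0n R).
set l := ln n%:R in yD pp *.
have l1 : 1 <= l by rewrite -ler_expR lnK.
have l0 : 0 < l by exact: lt_le_trans l1.
set r := _ + 1 in pp.
pose q := Num.sqrt l.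
have q1 : 1 <= q by rewrite -[leLHS]sqrtr1 ler_sqrt// ltW.
have rE : r = al * q + 1 by rewrite /r sqrtrM// divr_ge0// ltW.
have r1 : 1 <= r by rewrite rE lerDr mulr_ge0// (le_trans ler01).
apply: ge_ereal_sup => er erI.
(* a grid so fine that the rounding error is also of order [1 / n] *)
pose N := (Num.truncn (2 * r * n%:R)).+1.
have NE : 2 * r / N%:R <= n%:R^-1.
  by rewrite ler_pdivrMr ?ltr0n// ler_pdivlMl// mulrC ltW// truncnS_gt.
apply: (le_trans (IS_error_le M_lt B_gt0 W_normal n0 (ltn0Sn _ : (0 < N)%N)
  r1 pp y01 yD erI)).
rewrite lee_fin -/K0 powR_three_half// -/q.
have -> : - (1 / 2 - M) * (r - 1) ^+ 2 = - l.
  rewrite /r addrK sqr_sqrtr; last by rewrite mulr_ge0 ?divr_ge0// ltW.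
  by field; rewrite gt_eqF.
rewrite expRN lnK//.
have lp1 : 1 <= l ^+ d.-1 by rewrite exprn_ege1.
have qp1 : 1 <= q ^+ d by rewrite exprn_ege1.
have T1 : 1 <= q ^+ d * l ^+ d.-1 by rewrite mulr_ege1.
have r3 : (1 + 2 * r) ^+ d <= (3 + 2 * al) ^+ d * q ^+ d.
  have h0 : 0 <= 1 + 2 * r by lra.
  have h : 1 + 2 * r <= (3 + 2 * al) * q.
    suff : 0 <= 3 * (q - 1) by rewrite rE; lra.
    by rewrite mulr_ge0// subr_ge0.
  by rewrite -exprMn lerXn2r// ?nnegrE// (le_trans h0 h).
set T := n%:R^-1 * _.
have nT : n%:R^-1 <= T by rewrite /T ler_peMr// invr_ge0 ltW.
have iT : 0 <= n%:R^-1 :> R by rewrite invr_ge0 ltW.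
have E1 : 2 * (C * l ^+ d.-1 / n%:R) + d%:R / n%:R <=
    (2 * `|C| + d%:R) * (l ^+ d.-1 / n%:R).
  rewrite [leRHS]mulrDl; apply: lerD.
    rewrite -[leRHS]mulrA -[C * _ / _]mulrA ler_wpM2l// ler_wpM2r ?ler_norm//.
    by rewrite mulr_ge0// (le_trans ler01).
  by rewrite ler_wpM2l// ler_peMl.
rewrite [leRHS]mulrDl; apply: lerD; first (rewrite [leRHS]mulrDl; apply: lerD).
- apply: (@le_trans _ _ (K0 * ((3 + 2 * al) ^+ d * q ^+ d) *
      ((2 * `|C| + d%:R) * (l ^+ d.-1 / n%:R)))).
    apply: (@le_trans _ _ (K0 * (1 + 2 * r) ^+ d *
      ((2 * `|C| + d%:R) * (l ^+ d.-1 / n%:R)))).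
      by rewrite ler_wpM2l// mulr_ge0// exprn_ge0//; lra.
    rewrite ler_wpM2r//.
      by rewrite !mulr_ge0 ?addr_ge0// (le_trans ler01).
    by rewrite ler_wpM2l.
  by rewrite /T le_eqVlt; apply/orP; left; apply/eqP; ring.
- by rewrite -[2 * B * T]mulrA ler_wpM2l// ler_wpM2l// ltW.
- have -> : 2 * K0 * d%:R * T = 2 * (K0 * (d%:R * T)) by ring.
  by do 3!rewrite ler_wpM2l//; exact: le_trans NE nT.
Unshelve. all: by end_near. Qed.
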